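(* For each $n$, let $F_n$ be the distribution function of a real-valued statistic $X_n$, assumed to be strictly increasing. Let $\mathcal{X}_n=[-b_n,c_n]$, where $(b_n)$ and $(c_n)$ are sequences of positive numbers (possibly growing to infinity), and let $(a_n)$ be a sequence of positive numbers going to zero as $n\to\infty$. Let $\widehat F_n:\mathcal{X}_n\to\mathbb{R}$ be measurable functions such that $$F_n(x)=\widehat F_n(x)+\epsilon_n(x),\qquad|\epsilon_n(x)|\leq a_n\quad\text{for all }x\in\mathcal{X}_n.$$ Let $\widehat F_n^*$ be the increasing rearrangement of $\widehat F_n$ on $\mathcal{X}_n$. Then for every $n$ and every $p\in[1,\infty]$, $$\left[\int_{\mathcal{X}_n}\left|\widehat F_n^*(x)-F_n(x)\right|^p dx\right]^{1/p}\leq\left[\int_{\mathcal{X}_n}\left|\widehat F_n(x)-F_n(x)\right|^p dx\right]^{1/p}\leq(c_n+b_n)^{1/p}\,a_n,$$ and the first inequality is strict for $p\in(1,\infty)$ whenever $\widehat F_n$ is (strictly) decreasing over a subset of $\mathcal{X}_n$ of positive Lebesgue measure. In particular, this applies to the $J$-th order Edgeworth approximation to the distribution function of the sample mean: if $X_n=n^{-1/2}\sum_{i=1}^n(Y_i-E[Y_i])/\sqrt{\mathrm{Var}(Y_i)}$ is the standardized sample mean of a random sample $(Y_1,\dots,Y_n)$ of $Y$, with $F_n$ strictly increasing, if $$\widehat F_n(x)=P_1(x)+P_2(x)/n^{1/2}+\dots+P_J(x)/n^{(J-1)/2},$$ where $P_1,\dots,P_J$ are the terms of the Edgeworth expansion,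 and if for some $C>0$ one has $|F_n(x)-\widehat F_n(x)|\leq Cn^{-J/2}$ for all $x\in\mathcal{X}_n$, then for every $n$ and every $p\in[1,\infty]$, $$\left[\int_{\mathcal{X}_n}\left|\widehat F_n^*(x)-F_n(x)\right|^p dx\right]^{1/p}\leq\left[\int_{\mathcal{X}_n}\left|\widehat F_n(x)-F_n(x)\right|^p dx\right]^{1/p}\leq(c_n+b_n)^{1/p}\,Cn^{-J/2},$$ and the first inequality is strict for $p\in(1,\infty)$ whenever $\widehat F_n$ is (strictly) decreasing over a subset of $\mathcal{X}_n$ of positive Lebesgue measure.
   Context: Increasing rearrangement. For a bounded measurable function $f:[0,1]\to\mathbb{R}$, let $F_f(y)=\int_0^1 1\{f(u)\leq y\}\,du$. The increasing rearrangement of $f$ is the quantile function $f^*(x)=\inf\{y\in\mathbb{R}: F_f(y)\geq x\}$, $x\in[0,1]$ (the value at the single endpoint $x=0$ is immaterial). For a bounded measurable $f:[a,b]\to\mathbb{R}$ with $a<b$, put $\bar f(\bar x)=f(a+(b-a)\bar x)$ for $\bar x\in[0,1]$, and define $f^*(x)=\bar f^*\big((x-a)/(b-a)\big)$ for $x\in[a,b]$. For $p=\infty$ the $L_p$ norms are essential suprema and $(c_n+b_n)^{1/p}=1$. A function is decreasing over a set $A$ if its restriction to $A$ is strictly decreasing. $\Phi$ and $\phi$ are the standard normal distribution and density functions. The terms of the Edgeworth expansion are $P_1=\Phi$ and, for $j\geq2$, $P_j$ equal to $\phi$ times a polynomial with coefficients determined by moments of $Y$; the first three are $P_1(x)=\Phi(x)$,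 $P_2(x)=-\lambda(x^2-1)\phi(x)/6$, $P_3(x)=-(3\kappa(x^3-3x)+\lambda^2(x^5-10x^3+15x))\phi(x)/72$, where $\lambda$ is the skewness and $\kappa$ the (excess) kurtosis of $Y$. *)

(* Defs.v *)
From HB Require Import structures.
From mathcomp Require Import all_boot all_order all_algebra.
From mathcomp Require Import all_classical all_reals all_analysis.

Set Implicit Arguments.
Unset Strict Implicit.
Unset Printing Implicit Defensive.

Import Order.TTheory GRing.Theory Num.Theory.
Import numFieldNormedType.Exports.

Local Open Scope classical_set_scope.
Local Open Scope ring_scope.

Section Rearrangement.
Context {R : realType}.
Implicit Types (f : R -> R) (a b x y : R).

Definition level_cdf f y : \bar R :=
  (\int[lebesgue_measure]_(u in `[0%R, 1%R]) (\1_[set v | f v <= y] u)%:E)%E.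

(* At x = 0 the set below is all of R and the library returns inf = 0; this
   concerns a single point.  For x in ]0, 1] and f bounded on [0, 1], the set
   is nonempty and bounded below. *)
Definition rearrangement01 f x : R := inf [set y | (x%:E <= level_cdf f y)%E].

Definition rearrangement a b f x : R :=
  rearrangement01 (fun u => f (a + (b - a) * u)) ((x - a) / (b - a)).

(* The function is extended by 0 outside [a, b]; as it is |f| that enters the
   library's norm, for p = +oo and a < b this is the essential supremum of |f|
   over [a, b]. *)
Definition LnormI a b (p : \bar R) f : \bar R :=
  'N[lebesgue_measure]_p[EFin \o (f \_ `[a, b])]%E.

(* l^{1/p}, with 1/+oo = 0 *)
Definition root_length (l : R) (p : \bar R) : R :=
  if p is r%:E then l `^ r^-1 else 1.

Definition strictly_decreasing_on (A : set R) f : Prop :=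
  forall x y, A x -> A y -> x < y -> f y < f x.

End Rearrangement.

Section RandomSample.
Context {R : realType}.

Definition mutually_independent d (T : measurableType d)
    (P : probability T R) (n : nat) (Y : 'I_n -> {RV P >-> R}) : Prop :=
  forall (I : {set 'I_n}) (B : 'I_n -> set R),
    (forall i, measurable (B i)) ->
    P (\bigcap_(i in [set` I]) (Y i @^-1` B i)) =
    (\prod_(i in I) P (Y i @^-1` B i))%E.

Definition random_sample d0 (T0 : measurableType d0) (P0 : probability T0 R)
    (Y0 : {RV P0 >-> R}) d (T : measurableType d) (P : probability T R)
    (n : nat) (Y : 'I_n -> {RV P >-> R}) : Prop :=
  mutually_independent Y /\
  forall i (B : set R), measurable B ->
    distribution P (Y i) B = distribution P0 Y0 B.

Definition standardize d (T : measurableType d) (P : probability T R)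
    (Y : {RV P >-> R}) (w : T) : R :=
  (Y w - fine 'E_P[Y]) / Num.sqrt (fine 'V_P[Y]).

Definition standardized_mean d (T : measurableType d) (P : probability T R)
    (n : nat) (Y : 'I_n -> {RV P >-> R}) (w : T) : R :=
  (Num.sqrt n%:R)^-1 * \sum_(i < n) standardize (Y i) w.

Definition standardized_moment d (T : measurableType d) (P : probability T R)
    (Y : {RV P >-> R}) (k : nat) : R :=
  fine 'E_P[fun w => (standardize Y w ^+ k)%R].

End RandomSample.

Section Edgeworth.
Context {R : realType}.
Implicit Types (m : nat -> R).

(* The k-th cumulant as a polynomial in the moments m: k! times the
   coefficient of t^k in the formal series log(1 + \sum_(i >= 1) m_i t^i/i!). *)
Definition cumulant m (k : nat) : R :=
  k`!%:R *
  (\sum_(1 <= j < k.+1) ((-1) ^+ j.-1 / j%:R) *: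
     (\poly_(i < k.+1) (if i == 0%N then 0 else m i / i`!%:R)) ^+ j)`_k.

(* The characteristic function of the standardized mean of a sample of size n
   is formally
     exp(-t^2/2) exp(\sum_(k >= 1) kappa_(k+2) (it)^(k+2)/(k+2)! n^(-k/2)).
   The polynomial r_j below is, with u = it and s = n^(-1/2), the coefficient
   of s^j in the second exponential.  The outer indeterminate is s, the inner
   one is u. *)
Definition edgeworth_poly m (j : nat) : {poly R} :=
  (\sum_(l < j.+1) ((l`!%:R)^-1)%:P *:
     (\sum_(1 <= k < j.+1)
        ((cumulant m k.+2 / (k.+2)`!%:R) *: 'X^(k.+2) : {poly R}) *:
          ('X^k : {poly {poly R}})) ^+ l)`_j.

(* probabilists' Hermite polynomials *)
Fixpoint hermite (k : nat) : {poly R} :=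
  if k is k'.+1 then 'X * hermite k' - (hermite k')^`() else 1.

Definition normal_density (x : R) : R := normal_pdf 0 1 x.

Definition normal_cdf (x : R) : R := fine (normal_prob (0 : R) 1 `]-oo, x]).

(* Inverting the Fourier transform, n^(-j/2) has coefficient r_j(-D) Phi with
   D = d/dx, where (-D)^i Phi = - He_(i-1) phi for i >= 1, and r_j has no
   constant term when j >= 1.  The term of index j carries n^(-(j-1)/2); the
   index 0 is not used.  With skewness l = m_3 and excess kurtosis k = m_4 - 3
   of a standardized variable (m_1 = 0, m_2 = 1), the terms of index 2 and 3 are
     - l (x^2 - 1) phi(x) / 6  and
     - (3 k (x^3 - 3x) + l^2 (x^5 - 10 x^3 + 15 x)) phi(x) / 72. *)
Definition edgeworth_term m (j : nat) (x : R) : R :=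
  match j with
  | 0 => 0
  | 1 => normal_cdf x
  | j'.+2 =>
    let r := edgeworth_poly m j'.+1 in
    - (\sum_(1 <= i < size r) r`_i * (hermite i.-1).[x]) * normal_density x
  end.

Definition edgeworth_approx m (J n : nat) (x : R) : R :=
  \sum_(1 <= j < J.+1) edgeworth_term m j x / n%:R `^ (j.-1%:R / 2).

End Edgeworth.

(* Main.v *)
Require Import Defs.
From HB Require Import structures.
From mathcomp Require Import all_boot all_order all_algebra.
From mathcomp Require Import all_classical all_reals all_analysis.
From mathcomp Require Import measurable_realfun ess_sup_inf.

(* Fix psi >= 0 nondecreasing and a level z.  On the sublevel set {F <= z}, an
   initial segment, the increasing rearrangement f* sits below its values on the
   complement.  As f and f* are equimeasurable, so are their truncations at a
   threshold separating the two parts, whence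
     int_{F <= z} psi(f* - z) <= int_{F <= z} psi(f - z).
   With psi(t) = p t^(p-1) on t > 0, integrating over z (Tonelli) gives
     int ((f* - F)^+)^p <= int ((f - F)^+)^p,
   and the negative parts follow by changing the signs of f, f* and F.  If f
   decreases on a set of positive measure, then for a set of levels z of positive
   measure the truncation loses mass, which makes the inequality strict.  For
   p = oo, take for psi the indicators of half-lines and for z the rationals. *)

Import Order.TTheory GRing.Theory Num.Theory.
Import numFieldNormedType.Exports.

Local Open Scope classical_set_scope.
Local Open Scope ring_scope.


(** Let I be the initial segment, J its complement in D, u = psi(f - z) and v = psi(f* - z). For a
    threshold k with v <= k on I and k <= v on J, int_I v + k mu(J) = int_D min(v, k) = int_D min(u,
    k) <= int_I u + k mu(J). The term k mu(J) is finite and cancels, whether or not int_I u is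
    finite. Only the monotonicity of psi enters, so psi may jump; this admits the indicators, and p
    = 1. Strictness needs one gap valid for a whole interval of levels. A set on which f decreases
    is therefore cut into four pieces of positive measure. Points u1 < u2 of the two inner pieces
    give the gap: F u1 < F u2 bounds the levels, and f u1 > f u2 separates the values of f on the
    two outer pieces. At the left endpoint the infimum defining the rearrangement runs over all of R
    and carries no information. Hence the analysis takes place on ]l, u], with functions extended by
    0 to be measurable on the whole line. *)

Section StrictIntegral.
Local Open Scope ereal_scope.

(** The integral of f off A is finite and cancels. On A, a null integral of the positive function g
    - f would make it vanish almost everywhere, against [0 < mu A]. *)
Lemma lt_integral d (T : measurableType d) (R : realType)
    (mu : {measure set T -> \bar R}) (S A : set T) (f g : T -> \bar R) :
  measurable S -> measurable A -> A `<=` S -> 0 < mu A ->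
  measurable_fun S f -> measurable_fun S g ->
  (forall x, S x -> 0 <= f x) -> (forall x, S x -> f x <= g x) ->
  (forall x, A x -> f x < g x) -> \int[mu]_(x in S) f x < +oo ->
  \int[mu]_(x in S) f x < \int[mu]_(x in S) g x.
Proof.
move=> mS mA AS A0 mf mg f0 fg fgA foo.
have g0 x : S x -> 0 <= g x by move=> Sx; exact: le_trans (f0 _ Sx) (fg _ Sx).
have mSA : measurable (S `\` A) by exact: measurableD.
have SE : S = A `|` (S `\` A) by rewrite setDUK.
have dA : [disjoint A & S `\` A].
  by apply/disj_setPS => x [? []].
have split h : measurable_fun S h -> (forall x, S x -> 0 <= h x) ->
    \int[mu]_(x in S) h x = \int[mu]_(x in A) h x + \int[mu]_(x in S `\` A) h x.
  by move=> mh h0; rewrite {1}SE ge0_integral_setU// -SE.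
have mfA : measurable_fun A f by exact: measurable_funS mf.
have mgA : measurable_fun A g by exact: measurable_funS mg.
have fAoo : \int[mu]_(x in A) f x < +oo.
  by apply: le_lt_trans foo; apply: ge0_subset_integral.
have fSAoo : \int[mu]_(x in S `\` A) f x < +oo.
  by apply: le_lt_trans foo; apply: ge0_subset_integral => // x [].
rewrite (split f)// (split g)//.
apply: (@lt_le_trans _ _ 
  (\int[mu]_(x in A) g x + \int[mu]_(x in S `\` A) f x)); last first.
  apply: leeD2l; apply: ge0_le_integral => //.
  - by move=> x [/f0].
  - by apply: measurable_funS mf => // x [].
  - by apply: measurable_funS mg => // x [].
  - by move=> x [/fg].
rewrite lteD2rE; last first.
  by rewrite ge0_fin_numE// integral_ge0// => x [/f0].
have h0 x : A x -> 0 < g x - f x.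
  move=> Ax; rewrite sube_gt0; exact: fgA.
(* On A, f is finite because it lies strictly below g, while g may be infinite there. *)
have -> : \int[mu]_(x in A) g x = \int[mu]_(x in A) (f x + (g x - f x)).
  apply: eq_integral => x /set_mem Ax; rewrite addeC subeK//.
  rewrite ge0_fin_numE; last exact/f0/AS.
  by rewrite (lt_le_trans (fgA _ Ax))// leey.
have mh : measurable_fun A (fun x => g x - f x) by exact: emeasurable_funB.
rewrite ge0_integralD//; [|by move=> x /AS/f0|by move=> x /h0/ltW].
rewrite lteDl; last by rewrite ge0_fin_numE// integral_ge0// => x /AS/f0.
rewrite lt0e integral_ge0 ?andbT; last by move=> x /h0/ltW.
apply/eqP => h00.
have /(ae_eq_integral_abs mu mA mh) : \int[mu]_(x in A) `|g x - f x| = 0.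
  rewrite -h00; apply: eq_integral => x /set_mem Ax.
  by rewrite gee0_abs// ltW// h0.
case=> N [mN N0 AN].
have : mu A <= mu N.
  apply: le_measure; rewrite ?inE// => x Ax; apply: AN => /= /(_ Ax) H.
  by have := h0 x Ax; rewrite H ltxx.
by rewrite N0 leNgt A0.
Qed.

End StrictIntegral.

(** * Equimeasurable functions and integrals over lower sets *)

Definition equimeasurable {d} {T : measurableType d} {R : realType}
    (mu : set T -> \bar R) (D : set T) (u v : T -> R) :=
  forall B : set R, measurable B ->
    mu (D `&` u @^-1` B) = mu (D `&` v @^-1` B).

(** Ties of g leave v unconstrained: a sublevel set of g never separates tied points. *)
Definition comonotone_on {T} {R : realType} (D : set T) (v g : T -> R) :=
  forall x y, D x -> D y -> g x < g y -> v x <= v y.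

Section LowerSet.
Context d (T : measurableType d) (R : realType) (mu : {measure set T -> \bar R}).
Implicit Types (D I : set T) (u v : T -> R).

(** Immediate because equimeasurability quantifies over all Borel sets; [equimeasurable_rays]
    recovers that form from distribution functions. *)
Lemma equimeasurable_comp D (psi : R -> R) u v : measurable_fun setT psi ->
  equimeasurable mu D u v -> equimeasurable mu D (psi \o u) (psi \o v).
Proof.
move=> mpsi uv B mB; apply: (uv (psi @^-1` B)).
by rewrite -[_ @^-1` _]setTI; exact: mpsi.
Qed.

Lemma equimeasurable_integral D u v : measurable D ->
  measurable_fun setT u -> measurable_fun setT v ->
  (forall x, 0 <= u x) -> (forall x, 0 <= v x) ->
  equimeasurable mu D u v ->
  (\int[mu]_(x in D) (u x)%:E = \int[mu]_(x in D) (v x)%:E)%E.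
Proof.
move=> mD meas_u mv u0 v0 uv.
(* Shifting u and v by 1 separates their values on D from the value 0 that the
   restrictions take outside D. *)
have mid : measurable_fun (`[1%R, +oo[%classic : set R) (fun y => (y - 1)%:E).
  by apply/measurable_EFinP; exact: measurable_funB.
pose phi (w : T -> R) := ((fun x => w x + 1) \_ D : T -> R).
have phiE (w : T -> R) (A : set R) : (forall x, 0 <= w x) -> A `<=` `[1, +oo[ ->
    phi w @^-1` A = D `&` w @^-1` [set y | A (y + 1)].
  move=> w0 A1; apply/seteqP; split => x /=; rewrite /phi patchE.
    case: ifPn => [/set_mem//|_ /A1/=].
    by rewrite in_itv/= andbT lt_geF.
  by case=> /mem_set ->.
have mphi (w : T -> R) : measurable_fun setT w -> measurable_fun setT (phi w).
  move=> mw; apply/measurable_restrict => //; rewrite ?setTI.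
  by apply: measurable_funD => //; exact: measurable_funS mw.
have E (w : T -> R) : measurable_fun setT w -> (forall x, 0 <= w x) ->
   (\int[mu]_(x in D) (w x)%:E =
    \int[pushforward mu (phi w)]_(y in `[1%R, +oo[) (y - 1)%:E)%E.
  move=> mw w0; rewrite [RHS]ge0_integral_pushforward//; first last.
  - by move=> y /set_mem/=; rewrite in_itv/= andbT lee_fin subr_ge0.
  - exact: mphi.
  rewrite phiE//; rewrite (_ : D `&` _ = D).
    by apply: eq_integral => x xD /=; rewrite /phi patchE xD addrK.
  apply/setIidl => x _ /=.
  by rewrite in_itv/= andbT lerDr.
rewrite (E u)// (E v)//.
apply: eq_measure_integral; [exact: mphi..|] => mfv mfu A mA A1; rewrite /= /pushforward.
rewrite (phiE _ A v0 A1) (phiE _ A u0 A1); apply: uv.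
have -> : [set y | A (y + 1)] = (fun y => y + 1) @^-1` A by [].
rewrite -[_ @^-1` _]setTI.
exact: measurable_funD.
Qed.


Section Truncation.
Variables (D I : set T) (u v : T -> R).
Hypotheses (mD : measurable D) (mI : measurable I) (ID : I `<=` D).
Hypotheses (Doo : (mu D < +oo)%E).
Hypotheses (meas_u : measurable_fun setT u) (mv : measurable_fun setT v).
Hypotheses (u0 : forall x, 0 <= u x) (v0 : forall x, 0 <= v x).
Hypothesis (uv : equimeasurable mu D u v).
Hypothesis (lower : forall x y, I x -> (D `\` I) y -> v x <= v y).

(** The threshold is the supremum of v over I, finite because any value of v off I bounds it. For
    empty I the bound [v0] makes 0 a threshold. *)
Lemma lower_set_threshold : D `\` I !=set0 -> exists k, [/\ 0 <= k,
  forall x, I x -> v x <= k & forall y, (D `\` I) y -> k <= v y].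
Proof.
move=> [y0 y0J].
have [[x0 x0I]|/set0P/negP/negPn/eqP I0] := pselect (I !=set0); last first.
  by exists 0; split => // x; rewrite I0.
have hs : has_sup (v @` I).
  split; first by exists (v x0), x0.
  by exists (v y0) => _ [x xI <-]; exact: lower.
exists (sup (v @` I)); split.
- by apply: le_trans (v0 x0) _; apply: (sup_upper_bound hs); exists x0.
- by move=> x xI; apply: (sup_upper_bound hs); exists x.
- move=> y yJ; apply: ge_sup => [|_ [x xI <-]]; first by exists (v x0), x0.
  exact: lower.
Qed.

Let mJ : measurable (D `\` I). Proof. exact: measurableD. Qed.

Let split_integral (h : T -> R) : measurable_fun setT h -> (forall x, 0 <= h x) ->
  (\int[mu]_(x in D) (h x)%:E =
   \int[mu]_(x in I) (h x)%:E + \int[mu]_(x in D `\` I) (h x)%:E)%E.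
Proof.
move=> mh h0; rewrite -{1}(setDUK ID) ge0_integral_setU//.
- apply/measurable_EFinP; exact: measurable_funS mh.
- by move=> x _; rewrite lee_fin.
- by apply/disj_setPS => x [? []].
Qed.

(** Both sides are integrals over D of a function truncated at k. On the left it is v, which
    truncation leaves unchanged on I and makes constant off I. *)
Lemma lower_set_integral_truncation (k : R) : 0 <= k ->
  (forall x, I x -> v x <= k) -> (forall y, (D `\` I) y -> k <= v y) ->
  (\int[mu]_(x in I) (v x)%:E + k%:E * mu (D `\` I) =
   \int[mu]_(x in I) (Num.min (u x) k)%:E +
   \int[mu]_(x in D `\` I) (Num.min (u x) k)%:E)%E.
Proof.
move=> k0 kI kJ.
have mmin (w : T -> R) : measurable_fun setT w ->
    measurable_fun setT (fun x => Num.min (w x) k).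
  by move=> mw; exact: measurable_minr.
have min0 (w : T -> R) x : (forall x, 0 <= w x) -> 0 <= Num.min (w x) k.
  by move=> w0; rewrite le_min w0.
rewrite -split_integral; [|exact: mmin|by move=> x; exact: min0].
rewrite (@equimeasurable_integral D (fun x => Num.min (u x) k)
    (fun x => Num.min (v x) k))//;
  [|exact: mmin|exact: mmin|by move=> x; exact: min0|by move=> x; exact: min0|]; last first.
  by apply: (@equimeasurable_comp _ (fun y => Num.min y k)) => //; exact: measurable_minr.
rewrite split_integral; [|exact: mmin|by move=> x; exact: min0].
congr (_ + _)%E.
  by apply: eq_integral => x /set_mem /kI xk; rewrite min_l.
rewrite -integral_cst//; apply: eq_integral => x /set_mem /kJ xk.
by rewrite min_r.
Qed.

Let int_min_le (k : R) S : measurable S -> 0 <= k ->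
  (\int[mu]_(x in S) (Num.min (u x) k)%:E <= \int[mu]_(x in S) (u x)%:E)%E /\
  (\int[mu]_(x in S) (Num.min (u x) k)%:E <= k%:E * mu S)%E.
Proof.
move=> mS k0; rewrite -integral_cst//; split; apply: ge0_le_integral => //.
- by move=> x _; rewrite lee_fin le_min u0.
- apply/measurable_EFinP; apply: measurable_funS (measurable_minr meas_u _) => //.
- apply/measurable_EFinP; apply: measurable_funS meas_u => //.
- by move=> x _; rewrite lee_fin ge_min lexx.
- by move=> x _; rewrite lee_fin le_min u0.
- apply/measurable_EFinP; apply: measurable_funS (measurable_minr meas_u _) => //.
- by move=> x _; rewrite lee_fin ge_min lexx orbT.
Qed.

Let kJ_fin (k : R) : (k%:E * mu (D `\` I))%E \is a fin_num.
Proof.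
rewrite fin_numM// ge0_fin_numE//; apply: le_lt_trans Doo.
by apply: le_measure; rewrite ?inE.
Qed.

(** The truncation of u is at most u on I and at most k off I; [kJ_fin] permits the cancellation.
    When I = D there may be no threshold, but then the integrals over D agree. *)
Lemma lower_set_integral_le :
  (\int[mu]_(x in I) (v x)%:E <= \int[mu]_(x in I) (u x)%:E)%E.
Proof.
have [/lower_set_threshold[k [k0 kI kJ]]|/set0P/negP/negPn/eqP J0] :=
    pselect (D `\` I !=set0).
  rewrite -(leeD2rE _ _ (kJ_fin k)) lower_set_integral_truncation//.
  by apply: leeD; apply int_min_le.
have -> : I = D by apply/seteqP; split => //; rewrite -setD_eq0.
by rewrite (equimeasurable_integral D u v).
Qed.

Lemma lower_set_integral_lt A1 A2 (al be : R) :
  measurable A1 -> measurable A2 -> A1 `<=` I -> A2 `<=` D `\` I ->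
  (0 < mu A1)%E -> (0 < mu A2)%E -> be < al ->
  (forall x, A1 x -> al <= u x) -> (forall x, A2 x -> u x <= be) ->
  (\int[mu]_(x in I) (u x)%:E < +oo)%E ->
  (\int[mu]_(x in I) (v x)%:E < \int[mu]_(x in I) (u x)%:E)%E.
Proof.
move=> mA1 mA2 A1I A2J A10 A20 ba A1al A2be uoo.
have : D `\` I !=set0.
  suff [x xA2] : A2 !=set0 by exists x; exact: A2J.
  by apply/set0P/eqP => A2E; move: A20; rewrite A2E measure0 ltxx.
move=> /lower_set_threshold[k [k0 kI kJ]].
rewrite -(lteD2rE _ _ (kJ_fin k)) lower_set_integral_truncation//.
have mumin S : measurable S -> measurable_fun S (fun x => (Num.min (u x) k)%:E).
  by move=> mS; apply/measurable_EFinP; apply: measurable_funS (measurable_minr meas_u _).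
have min0 x : (0 <= (Num.min (u x) k)%:E)%E by rewrite lee_fin le_min u0.
have mine_ S : measurable S -> measurable_fun S (fun x => (u x)%:E).
  by move=> mS; apply/measurable_EFinP; apply: measurable_funS meas_u.
have minoo : (\int[mu]_(x in I) (Num.min (u x) k)%:E < +oo)%E.
  by apply: le_lt_trans uoo; apply int_min_le.
have leJ : (\int[mu]_(x in D `\` I) (Num.min (u x) k)%:E <= k%:E * mu (D `\` I))%E.
  by apply int_min_le.
have Joo : (\int[mu]_(x in D `\` I) (Num.min (u x) k)%:E < +oo)%E.
  by apply: le_lt_trans leJ _; rewrite ltey_eq kJ_fin.
(* Either k < al, and truncating at k lowers u on A1, or be < al <= k, and u
   stays below k on A2. *)
have [ka|ak] := ltP k al.
  apply: lte_leD.
  - by rewrite ge0_fin_numE ?integral_ge0.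
  - apply: (@lt_integral _ _ _ _ _ A1) => //.
    + exact: mumin.
    + exact: mine_.
    + by move=> x _; rewrite lee_fin ge_min lexx.
    + move=> x /A1al ux; rewrite lte_fin gt_min; apply/orP; right.
      exact: lt_le_trans ux.
  - exact: leJ.
apply: lee_ltD.
- by rewrite ge0_fin_numE ?integral_ge0.
- by apply int_min_le.
- rewrite -integral_cst//; apply: (@lt_integral _ _ _ _ _ A2) => //.
  + exact: mumin.
  + by move=> x _; rewrite lee_fin ge_min lexx orbT.
  + move=> x /A2be ux; rewrite lte_fin gt_min; apply/orP; left.
    by apply: le_lt_trans ux _; exact: lt_le_trans ak.
Qed.

End Truncation.
End LowerSet.

(** * Integration over the levels of g *)

Section Crossing.
Context d (T : measurableType d) (R : realType).
Variables (mu : {sigma_finite_measure set T -> \bar R}) (D : set T).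
Variables (g : T -> R) (psi : R -> R).
Hypotheses (mD : measurable D) (Doo : (mu D < +oo)%E).
Hypotheses (mg : measurable_fun setT g).
Hypotheses (psi_nd : nondecreasing_fun psi) (psi0 : forall t, 0 <= psi t).
Implicit Types (w f fs : T -> R).

Definition sublevel (z : R) : set T := D `&` [set x | g x <= z].

Definition sublevel_integral w (z : R) : \bar R :=
  (\int[mu]_(x in sublevel z) (psi (w x - z))%:E)%E.

(** Integrated in x it gives [sublevel_integral], in z the inner integral of
    [sublevel_integral_tonelli]; its joint measurability yields both the measurability in z and the
    exchange. *)
Let ker w (xz : T * R) : \bar R :=
  ((fun xz : T * R => (psi (w xz.1 - xz.2))%:E)
   \_ [set xz | D xz.1 /\ g xz.1 <= xz.2]) xz.

Let mpsi : measurable_fun setT psi.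
Proof. exact: nondecreasing_measurable. Qed.

Lemma measurable_sublevel z : measurable (sublevel z).
Proof.
have -> : sublevel z = D `&` g @^-1` `]-oo, z].
  by apply/seteqP; split => x /=; rewrite in_itv/=.
by apply: measurableI => //; rewrite -[_ @^-1` _]setTI; exact: mg.
Qed.

Let mker w : measurable_fun setT w -> measurable_fun setT (ker w).
Proof.
move=> mw; apply/measurable_restrict => //; last first.
  rewrite setTI; apply/measurable_EFinP; apply: measurable_funTS.
  apply: (@measurableT_comp _ _ _ _ _ _ psi) => //.
  by apply: measurable_funB => //; exact: measurableT_comp.
have -> : [set xz : T * R | D xz.1 /\ g xz.1 <= xz.2] =
    (D `*` setT) `&` (fun xz : T * R => g xz.1 - xz.2) @^-1` `]-oo, 0].
  apply/seteqP; split => xz /=; rewrite in_itv/= subr_le0; first by case.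
  by case=> -[].
apply: measurableI; first exact: measurableX.
rewrite -[_ @^-1` _]setTI.
have : measurable_fun setT (fun xz : T * R => g xz.1 - xz.2).
  by apply: measurable_funB => //; exact: measurableT_comp.
by apply.
Qed.

Let ker0 w xz : (0 <= ker w xz)%E.
Proof. by rewrite /ker patchE; case: ifPn => // _; rewrite lee_fin. Qed.

Let ker_sublevel w z : (\int[mu]_x ker w (x, z) = sublevel_integral w z)%E.
Proof.
rewrite /sublevel_integral [RHS]integral_mkcond; apply: eq_integral => x _.
rewrite /ker !patchE.
have -> : ((x, z) \in [set xz : T * R | D xz.1 /\ g xz.1 <= xz.2]) = (x \in sublevel z).
  by apply/idP/idP => /set_mem ?; apply/mem_set.
by case: ifPn.
Qed.

Lemma measurable_sublevel_integral w : measurable_fun setT w ->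
  measurable_fun setT (sublevel_integral w).
Proof.
move=> mw; rewrite (_ : sublevel_integral w = fubini_G mu (ker w)).
  exact: measurable_fun_fubini_tonelli_G (mker _ mw) (ker0 w).
by apply/funext => z; rewrite -ker_sublevel.
Qed.

Lemma sublevel_integral_ge0 w z : (0 <= sublevel_integral w z)%E.
Proof. by apply: integral_ge0 => x _; rewrite lee_fin. Qed.

(** For fixed x in D, the levels z whose sublevel set contains x form [g x, +oo[. *)
Lemma sublevel_integral_tonelli w : measurable_fun setT w ->
  (\int[lebesgue_measure]_z sublevel_integral w z =
   \int[mu]_(x in D)
     \int[lebesgue_measure]_(z in `[g x, +oo[) (psi (w x - z))%:E)%E.
Proof.
move=> mw; under eq_integral do rewrite -ker_sublevel.
rewrite -(@fubini_tonelli _ _ _ _ _ mu lebesgue_measure _ (mker _ mw) (ker0 w)).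
rewrite [RHS]integral_mkcond; apply: eq_integral => x _.
rewrite patchE; case: ifPn => xD.
  rewrite [RHS]integral_mkcond; apply: eq_integral => z _; rewrite /ker !patchE.
  have -> : ((x, z) \in [set xz : T * R | D xz.1 /\ g xz.1 <= xz.2]) =
      (z \in `[g x, +oo[%classic).
    apply/idP/idP => /set_mem /=.
      by case=> _ gz; apply/mem_set; rewrite /= in_itv/= gz.
    by rewrite in_itv/= andbT => gz; apply/mem_set; split => //; exact: set_mem.
  by case: ifPn.
apply: integral0_eq => z _; rewrite /ker patchE; case: ifPn => // /set_mem[/= xD'].
by move: xD; rewrite mem_set.
Qed.

Variables (f fs : T -> R).
Hypotheses (mf : measurable_fun setT f) (mfs : measurable_fun setT fs).
Hypotheses (eqf : equimeasurable mu D f fs) (cofs : comonotone_on D fs g).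

Let mpsiB z (w : T -> R) : measurable_fun setT w ->
  measurable_fun setT (fun x => psi (w x - z)).
Proof.
move=> mw; apply: (@measurableT_comp _ _ _ _ _ _ psi) => //.
exact: measurable_funB.
Qed.

Let eq_psi z : equimeasurable mu D (fun x => psi (f x - z)) (fun x => psi (fs x - z)).
Proof.
apply: (@equimeasurable_comp _ _ _ _ _ (fun y => psi (y - z))) => //.
by apply: (@measurableT_comp _ _ _ _ _ _ psi) => //; exact: measurable_funB.
Qed.

Let lower z x y : sublevel z x -> (D `\` sublevel z) y ->
  psi (fs x - z) <= psi (fs y - z).
Proof.
move=> [xD /= gx] [yD] /not_andP[//|/negP]; rewrite -ltNge => gy.
by apply: psi_nd; rewrite lerB// cofs// (le_lt_trans gx).
Qed.

Lemma sublevel_integral_le z :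
  (sublevel_integral fs z <= sublevel_integral f z)%E.
Proof.
apply: (@lower_set_integral_le _ _ _ _ D) => //.
- exact: measurable_sublevel.
- by move=> x [].
- exact: mpsiB.
- exact: mpsiB.
- exact: lower.
Qed.

(** For w1 < z < w2 the sublevel set contains A1 and misses A2, so [lower_set_integral_lt] applies
    at each such level, and these levels have positive measure. *)
Lemma integral_sublevel_integral_lt A1 A2 (v1 v2 w1 w2 : R) :
  measurable A1 -> measurable A2 -> A1 `<=` D -> A2 `<=` D ->
  (0 < mu A1)%E -> (0 < mu A2)%E -> w1 < w2 ->
  (forall x, A1 x -> v1 <= f x) -> (forall x, A2 x -> f x <= v2) ->
  (forall x, A1 x -> g x <= w1) -> (forall x, A2 x -> w2 <= g x) ->
  (forall z, w1 < z < w2 -> psi (v2 - z) < psi (v1 - z)) ->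
  (\int[lebesgue_measure]_z sublevel_integral f z < +oo)%E ->
  (\int[lebesgue_measure]_z sublevel_integral fs z <
   \int[lebesgue_measure]_z sublevel_integral f z)%E.
Proof.
move=> mA1 mA2 A1D A2D A10 A20 w12 A1v A2v A1w A2w psi_lt foo.
have mSf := measurable_sublevel_integral _ mf.
have mSfs := measurable_sublevel_integral _ mfs.
(* Strictness at a level requires a finite integral there; the null set N of levels where this fails
   is removed from ]w1, w2[. *)
have fin_ae : {ae lebesgue_measure, forall z : R, (sublevel_integral f z < +oo)%E}.
  have : lebesgue_measure.-integrable setT (sublevel_integral f).
    apply/integrableP; split => //.
    by under eq_integral do rewrite gee0_abs ?sublevel_integral_ge0//.
  move=> /integrable_ae - /(_ measurableT).
  apply: filterS => z /(_ Logic.I); rewrite ge0_fin_numE//.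
  exact: sublevel_integral_ge0.
case: fin_ae => N [mN N0 Nsub].
apply: (@lt_integral _ _ _ lebesgue_measure setT (`]w1, w2[ `\` N)).
- exact: measurableT.
- exact: measurableD.
- exact: subsetT.
- rewrite measureD//=; last by rewrite lebesgue_measure_itv/= lte_fin w12 ltry.
  rewrite (_ : lebesgue_measure (_ `&` N) = 0%E) ?sube0; last first.
    by apply: (subset_measure0 _ mN _ N0) => //; exact: measurableI.
  by rewrite lebesgue_measure_itv/= lte_fin w12 EFinN -EFinB lte_fin subr_gt0.
- exact: mSfs.
- exact: mSf.
- by move=> z _; exact: sublevel_integral_ge0.
- by move=> z _; exact: sublevel_integral_le.
- move=> z [/=]; rewrite in_itv/= => /[dup] /psi_lt psiz /andP[w1z zw2] zN.
  have sD : sublevel z `<=` D by move=> x [].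
  apply: (@lower_set_integral_lt _ _ _ mu D (sublevel z) _ _ mD
    (measurable_sublevel z) sD Doo (mpsiB z _ mf) (mpsiB z _ mfs)
    (fun x => psi0 _) (fun x => psi0 _) (eq_psi z) (lower z) A1 A2
    (psi (v1 - z)) (psi (v2 - z))) => //.
  + move=> x A1x; split; first exact: A1D.
    by apply: le_trans (A1w _ A1x) _; exact: ltW.
  + move=> x A2x; split; first exact: A2D.
    move=> [_ /=]; apply/negP; rewrite -ltNge.
    by apply: lt_le_trans zw2 _; exact: A2w.
  + by move=> x A1x; apply: psi_nd; rewrite lerB// A1v.
  + by move=> x A2x; apply: psi_nd; rewrite lerB// A2v.
  + by apply: contrapT => /Nsub.
- apply: le_lt_trans foo; apply: ge0_le_integral => //.
  + by move=> z _; exact: sublevel_integral_ge0.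
  + by move=> z _; exact: sublevel_integral_le.
Qed.

End Crossing.

(** * Positive powers as integrals of their derivatives *)

Section PositivePower.
Context (R : realType).
Implicit Types (p t a b : R).

(* The derivative of t |-> (max t 0)^p.  The test is needed because the library
   has t `^ q = 1 for t < 0 and 0 `^ 0 = 1. *)
Definition dpospow p t : R := if 0 < t then p * t `^ (p - 1) else 0.

Lemma dpospow_ge0 p t : 1 <= p -> 0 <= dpospow p t.
Proof.
move=> p1; rewrite /dpospow; case: ifPn => // t0.
by rewrite mulr_ge0 ?powR_ge0// (le_trans ler01).
Qed.

Lemma dpospow_nd p : 1 <= p -> nondecreasing_fun (dpospow p).
Proof.
move=> p1 s t st; rewrite {1}/dpospow; case: ifPn => s0; last exact: dpospow_ge0.
rewrite /dpospow (lt_le_trans s0 st) ler_pM2l ?(lt_le_trans ltr01)//.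
by rewrite ge0_ler_powR ?nnegrE ?subr_ge0// ltW// (lt_le_trans s0).
Qed.

(** For p = 1 the function is the indicator of t > 0 and strictness fails between positive points;
    this is where p > 1 enters the strict inequality. *)
Lemma dpospow_lt p s t : 1 < p -> s < t -> 0 < t -> dpospow p s < dpospow p t.
Proof.
move=> p1 st t0; rewrite /dpospow t0.
have p0 : 0 < p by exact: lt_trans p1.
case: ifPn => s0; last by rewrite mulr_gt0// powR_gt0.
by rewrite ltr_pM2l// gt0_ltr_powR ?subr_gt0 ?nnegrE// ltW.
Qed.

(** Supplies the endpoint z = b, which [is_derive_powR_sub] excludes. *)
Lemma cvg_powR_sub_left p b : 0 < p -> (b - z) `^ p @[z --> b^'-] --> 0.
Proof.
move=> p0; apply/cvgrPdist_le => e e0.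
have /cvgrPdist_le/(_ e e0) := powR_cvg0 p0.
rewrite !near_withinE => -[/= r r0 H].
exists r => //= z /= zb zltb.
apply: H; last by rewrite subr_gt0.
by rewrite /= sub0r normrN.
Qed.

Lemma is_derive_powR_sub p b (z : R) : z < b ->
  is_derive z 1 (fun z => (b - z) `^ p) (- (p * (b - z) `^ (p - 1))).
Proof.
move=> zb.
have h1 : is_derive (b - z) 1 (@powR R ^~ p) (p * (b - z) `^ (p - 1)).
  by apply: is_derive1_powR; rewrite subr_gt0.
have h2 : is_derive z 1 (fun z : R => b - z) (-1).
  by rewrite -[-1]sub0r; apply: is_deriveB.
have := @is_derive1_comp R (@powR R ^~ p) (fun z => b - z) z _ _ h1 h2.
by rewrite mulrN1.
Qed.

Lemma continuous_powR_sub p b (z : R) : z < b ->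
  {for z, continuous (fun z => (b - z) `^ p)}.
Proof.
move=> zb; apply/differentiable_continuous/derivable1_diffP.
by have [] := is_derive_powR_sub p b z zb.
Qed.

Lemma integral_dpospow p a b : 1 <= p ->
  (\int[lebesgue_measure]_(z in `[a, +oo[) (dpospow p (b - z))%:E =
   ((Num.max (b - a) 0) `^ p)%:E)%E.
Proof.
move=> p1; have p0 : 0 < p by exact: lt_le_trans p1.
have [ba|ab] := leP b a.
  rewrite max_r ?subr_le0// powR0 ?gt_eqF//.
  apply: integral0_eq => z /=; rewrite in_itv/= andbT => az.
  by rewrite /dpospow subr_gt0 ltNge (le_trans ba az).
rewrite max_l ?subr_ge0 ?(ltW ab)//.
have mitv (i : interval R) (h : R -> R) : measurable_fun setT h ->
    measurable_fun [set` i] (fun z => (h z)%:E).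
  by move=> mh; apply/measurable_EFinP; exact: measurable_funS mh.
have mh : measurable_fun setT (fun z : R => p * (b - z) `^ (p - 1)).
  apply: measurable_funM => //.
  apply: (@measurableT_comp _ _ _ _ _ _ (@powR R ^~ (p - 1))) => //.
  exact: measurable_funB.
transitivity (\int[lebesgue_measure]_(z in `[a, b[) (p * (b - z) `^ (p - 1))%:E)%E.
  rewrite integral_mkcond [RHS]integral_mkcond; apply: eq_integral => z _.
  rewrite !patchE.
  have -> : (z \in `[a, b[%classic) = (z \in `[a, +oo[%classic) && (z < b).
    apply/idP/andP.
      by move=> /set_mem /=; rewrite in_itv/= => /andP[az zb]; split => //;
         apply/mem_set; rewrite /= in_itv/= az.
    case=> /set_mem /=; rewrite in_itv/= andbT => az zb.
    by apply/mem_set; rewrite /= in_itv/= az.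
  case: ifPn => //= _; rewrite /dpospow subr_gt0.
  by case: ifPn.
rewrite integral_itv_bndo_bndc; last exact: mitv.
pose F (z : R) := - (b - z) `^ p.
rewrite (@continuous_FTC2 _ _ F)//.
- by rewrite /F subrr powR0 ?gt_eqF// oppr0 sub0e -EFinN opprK.
- apply/continuous_within_itvP => //; split.
  + move=> z; rewrite in_itv/= => /andP[_ zb].
    by apply: cvgM; [exact: cvg_cst|exact: continuous_powR_sub].
  + apply: cvgM; [exact: cvg_cst|apply: cvg_at_right_filter].
    exact: continuous_powR_sub.
  (* At b the integrand is the constant 1 if p = 1, and tends to 0 if p > 1. *)
  + have [->|p1'] := eqVneq p 1.
      rewrite subrr; under eq_cvg do rewrite powRr0.
      by rewrite powRr0; exact: cvg_cst.
    have p10 : 0 < p - 1 by rewrite subr_gt0 lt_neqAle eq_sym p1'.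
    apply: cvgM; first exact: cvg_cst.
    by rewrite subrr powR0 ?gt_eqF//; exact: cvg_powR_sub_left.
- split.
  + move=> z; rewrite in_itv/= => /andP[_ zb].
    have dz := is_derive_powR_sub p b z zb.
    by apply: derivableN; case: dz.
  + apply: cvgN; apply: cvg_at_right_filter; exact: continuous_powR_sub.
  + apply: cvgN.
    by rewrite subrr powR0 ?gt_eqF//; exact: cvg_powR_sub_left.
- move=> z; rewrite in_itv/= => /andP[_ zb].
  have dz := is_derive_powR_sub p b z zb.
  by rewrite derive1E; have [_ ->] := is_deriveN dz; rewrite opprK.
Qed.

Lemma powR_norm_split p t : 0 < p ->
  `|t| `^ p = (Num.max t 0) `^ p + (Num.max (- t) 0) `^ p.
Proof.
move=> p0; have [t0|t0] := leP 0 t.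
  by rewrite ger0_norm// [in X in _ + X]max_r ?oppr_le0// powR0 ?gt_eqF// addr0.
by rewrite ltr0_norm// [in X in _ + X]max_l ?oppr_ge0 ?ltW// powR0 ?gt_eqF// add0r.
Qed.

End PositivePower.

(** * Distances to g before and after rearranging f in the order of g *)

Section Comonotone.
Context d (T : measurableType d) (R : realType).
Variables (mu : {sigma_finite_measure set T -> \bar R}) (D : set T).
Hypotheses (mD : measurable D) (Doo : (mu D < +oo)%E).

Lemma equimeasurableN (f fs : T -> R) : equimeasurable mu D f fs ->
  equimeasurable mu D (fun x => - f x) (fun x => - fs x).
Proof.
move=> ffs; apply: (equimeasurable_comp _ _ _ _ _ (fun y => - y)) => //.
exact: oppr_measurable.
Qed.

Lemma comonotone_onN (f g : T -> R) : comonotone_on D f g ->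
  comonotone_on D (fun x => - f x) (fun x => - g x).
Proof. by move=> fg x y Dx Dy; rewrite ltrN2 lerN2 => /fg; apply. Qed.

Definition excess p (u g : T -> R) : \bar R :=
  (\int[mu]_(x in D) ((Num.max (u x - g x) 0) `^ p)%:E)%E.

Lemma excessE p (u g : T -> R) : 1 <= p -> measurable_fun setT u ->
  measurable_fun setT g ->
  excess p u g =
  (\int[lebesgue_measure]_z sublevel_integral _ _ _ mu D g (dpospow R p) u z)%E.
Proof.
move=> p1 meas_u mg; rewrite sublevel_integral_tonelli//.
- by apply: eq_integral => x _; rewrite integral_dpospow.
- exact: dpospow_nd.
- by move=> t; exact: dpospow_ge0.
Qed.

Let mexcess p (u g : T -> R) : measurable_fun setT u -> measurable_fun setT g ->
  measurable_fun D (fun x => ((Num.max (u x - g x) 0) `^ p)%:E).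
Proof.
move=> meas_u mg; apply/measurable_EFinP; apply: measurable_funTS.
apply: (@measurableT_comp _ _ _ _ _ _ (@powR R ^~ p)) => //.
by apply: measurable_maxr => //; exact: measurable_funB.
Qed.

Lemma integral_norm_excess p (u g : T -> R) : 1 <= p ->
  measurable_fun setT u -> measurable_fun setT g ->
  (\int[mu]_(x in D) (`|u x - g x| `^ p)%:E =
   excess p u g + excess p (\- u)%R (\- g)%R)%E.
Proof.
move=> p1 meas_u mg; rewrite -ge0_integralD//.
- apply: eq_integral => x _; rewrite powR_norm_split ?(lt_le_trans ltr01)// EFinD.
  by rewrite opprB opprK [- u x + g x]addrC.
- by move=> x _; rewrite lee_fin powR_ge0.
- exact: mexcess.
- by move=> x _; rewrite lee_fin powR_ge0.
- by apply: mexcess; exact: measurable_funN.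
Qed.

Lemma excess_le p (f fs g : T -> R) : 1 <= p ->
  measurable_fun setT f -> measurable_fun setT fs -> measurable_fun setT g ->
  equimeasurable mu D f fs -> comonotone_on D fs g ->
  (excess p fs g <= excess p f g)%E.
Proof.
move=> p1 mf mfs mg ffs cofs.
rewrite (excessE _ _ _ p1 mfs mg) (excessE _ _ _ p1 mf mg).
have nd := dpospow_nd R p p1.
have ge0 t := dpospow_ge0 R p t p1.
apply: ge0_le_integral.
- exact: measurableT.
- by move=> z _; exact: sublevel_integral_ge0.
- exact: measurable_sublevel_integral.
- exact: measurable_sublevel_integral.
- by move=> z _; exact: sublevel_integral_le.
Qed.

Section Comparison.
Variables (f fs g : T -> R).
Hypotheses (mf : measurable_fun setT f) (mfs : measurable_fun setT fs).
Hypotheses (mg : measurable_fun setT g).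
Hypotheses (ffs : equimeasurable mu D f fs) (cofs : comonotone_on D fs g).

Lemma comonotone_integral_norm_le p : 1 <= p ->
  (\int[mu]_(x in D) (`|fs x - g x| `^ p)%:E <=
   \int[mu]_(x in D) (`|f x - g x| `^ p)%:E)%E.
Proof.
move=> p1; rewrite (integral_norm_excess _ _ _ p1 mfs mg)
  (integral_norm_excess _ _ _ p1 mf mg).
apply: leeD; first exact: excess_le.
apply: (excess_le _ _ _ _ p1 (measurable_funN mf) (measurable_funN mfs)
  (measurable_funN mg) (equimeasurableN _ _ ffs)).
exact: comonotone_onN.
Qed.

Lemma comonotone_integral_norm_lt p A1 A2 (v1 v2 w1 w2 : R) : 1 < p ->
  measurable A1 -> measurable A2 -> A1 `<=` D -> A2 `<=` D ->
  (0 < mu A1)%E -> (0 < mu A2)%E -> v2 < v1 -> w1 < w2 ->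
  (forall x, A1 x -> v1 <= f x) -> (forall x, A2 x -> f x <= v2) ->
  (forall x, A1 x -> g x <= w1) -> (forall x, A2 x -> w2 <= g x) ->
  (\int[mu]_(x in D) (`|f x - g x| `^ p)%:E < +oo)%E ->
  (\int[mu]_(x in D) (`|fs x - g x| `^ p)%:E <
   \int[mu]_(x in D) (`|f x - g x| `^ p)%:E)%E.
Proof.
move=> p1 mA1 mA2 A1D A2D A10 A20 v21 w12 A1v A2v A1w A2w.
have p1' := ltW p1.
have nd := dpospow_nd R p p1'.
have ge0 t := dpospow_ge0 R p t p1'.
have mN (u : T -> R) : measurable_fun setT u -> measurable_fun setT (fun x => - u x).
  by move=> ?; exact: measurable_funN.
have ex0 u h : (0 <= excess p u h)%E.
  by apply: integral_ge0 => x _; rewrite lee_fin powR_ge0.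
rewrite (integral_norm_excess _ _ _ p1' mfs mg)
  (integral_norm_excess _ _ _ p1' mf mg) => foo.
have foo1 : (excess p f g < +oo)%E by apply: le_lt_trans foo; rewrite leeDl.
have foo2 : (excess p (\- f)%R (\- g)%R < +oo)%E.
  by apply: le_lt_trans foo; rewrite leeDr.
have le1 := excess_le _ _ _ _ p1' mf mfs mg ffs cofs.
have le2 := excess_le _ _ _ _ p1' (mN _ mf) (mN _ mfs) (mN _ mg)
  (equimeasurableN _ _ ffs) (comonotone_onN _ _ cofs).
(* If v1 <= w1, no level of ]w1, w2[ need lie below f on A1, but all lie above
   v1 > v2 >= f on A2: the strict inequality comes from the negative part. *)
have [vw|wv] := leP v1 w1.
  apply: (lee_ltD _ le1).
    by rewrite (ge0_fin_numE (ex0 _ _)); exact: le_lt_trans foo1.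
  rewrite (excessE _ _ _ p1' (mN _ mfs) (mN _ mg))
    (excessE _ _ _ p1' (mN _ mf) (mN _ mg)).
  (* The sign change reverses the orders of f and g, so A1 and A2 exchange roles. *)
  apply: (integral_sublevel_integral_lt _ _ _ mu D _ _ mD Doo (mN _ mg) nd ge0 _ _
     (mN _ mf) (mN _ mfs) (equimeasurableN _ _ ffs) (comonotone_onN _ _ cofs)
     A2 A1 (- v2) (- v1) (- w2) (- w1) mA2 mA1 A2D A1D A20 A10).
  - by rewrite ltrN2.
  - by move=> x /A2v; rewrite lerN2.
  - by move=> x /A1v; rewrite lerN2.
  - by move=> x /A2w; rewrite lerN2.
  - by move=> x /A1w; rewrite lerN2.
  - move=> z /andP[z1 z2]; apply: dpospow_lt => //.
      by rewrite ltrD2r ltrN2.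
    rewrite subr_gt0 (lt_trans z2)// ltrN2.
    exact: lt_le_trans vw.
  - rewrite -(excessE _ _ _ p1' (mN _ mf) (mN _ mg)); exact: foo2.
apply: (lte_leD _ _ le2).
  by rewrite (ge0_fin_numE (ex0 _ _)); exact: le_lt_trans foo2.
rewrite (excessE _ _ _ p1' mfs mg) (excessE _ _ _ p1' mf mg).
(* Levels stop at v1: [dpospow_lt] needs v1 - z > 0. *)
apply: (integral_sublevel_integral_lt _ _ _ mu D _ _ mD Doo mg nd ge0 _ _
   mf mfs ffs cofs A1 A2 v1 v2 w1 (Num.min w2 v1) mA1 mA2 A1D A2D A10 A20).
- by rewrite lt_min w12.
- exact: A1v.
- exact: A2v.
- exact: A1w.
- by move=> x /A2w; rewrite ge_min => ->.
- move=> z; rewrite lt_min => /and3P[z1 z2 z3]; apply: dpospow_lt => //.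
    by rewrite ltrD2r.
  by rewrite subr_gt0.
- rewrite -(excessE _ _ _ p1' mf mg); exact: foo1.
Qed.

(** If fs x - g x > M, some rational q satisfies g x < q < fs x - M. So the countably many sets
    [S fs q] cover the exceptional points, and each is null because [S f q] is. *)
Lemma comonotone_ae_le (M : R) :
  {ae mu, forall x, D x -> f x - g x <= M} ->
  {ae mu, forall x, D x -> fs x - g x <= M}.
Proof.
move=> fM.
pose S (u : T -> R) (q : rat) := D `&` [set x | g x < ratr q] `&`
  [set x | ratr q + M < u x].
have mlt (q : R) : measurable (D `&` [set x | g x < q]).
  have -> : [set x | g x < q] = g @^-1` `]-oo, q[.
    by apply/seteqP; split => x /=; rewrite in_itv/=.
  by apply: measurableI => //; rewrite -[_ @^-1` _]setTI; exact: mg.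
have mgt (u : T -> R) (q : R) : measurable_fun setT u -> measurable [set x | q < u x].
  move=> meas_u; have -> : [set x | q < u x] = u @^-1` `]q, +oo[.
    by apply/seteqP; split => x /=; rewrite in_itv/= andbT.
  by rewrite -[_ @^-1` _]setTI; exact: meas_u.
have mS u q : measurable_fun setT u -> measurable (S u q).
  by move=> meas_u; apply: measurableI => //; exact: mgt.
have Sle q : (mu (S fs q) <= mu (S f q))%E.
  pose ind (t : R) : R := \1_(`]ratr q + M, +oo[%classic : set R) t.
  have ind0 t : 0 <= ind t by rewrite /ind indicE.
  have mind : measurable_fun setT ind by exact: measurable_indic.
  have SE u : measurable_fun setT u ->
      mu (S u q) = (\int[mu]_(x in D `&` [set x | g x < ratr q]%R) (ind (u x))%:E)%E.
    move=> meas_u; rewrite /S setIC -integral_indic//; last exact: mgt.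
    apply: eq_integral => x _; rewrite /ind !indicE; congr (_%:R%:E).
    by congr (nat_of_bool _); apply/idP/idP => /set_mem /=;
      rewrite ?in_itv/= ?andbT => h; apply/mem_set; rewrite /= ?in_itv/= ?andbT.
  rewrite !SE//.
  apply: (lower_set_integral_le _ _ _ mu D) => //.
  - exact: measurableT_comp.
  - exact: measurableT_comp.
  - exact: (equimeasurable_comp _ _ _ _ _ ind).
  - move=> x y [Dx /= gx] [Dy] /not_andP[//|/negP]; rewrite -leNgt => gy.
    have fsxy : fs x <= fs y by apply: cofs => //; exact: lt_le_trans gy.
    rewrite /ind !indicE ler_nat.
    have : fs x \in `]ratr q + M, +oo[%classic -> fs y \in `]ratr q + M, +oo[%classic.
      move=> /set_mem/=; rewrite in_itv/= andbT => h; apply/mem_set.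
      by rewrite /= in_itv/= andbT; exact: lt_le_trans fsxy.
    by case: (_ \in _) => // ->.
have Sf0 q : mu (S f q) = 0%E.
  case: fM => N [mN N0 NM]; apply: (subset_measure0 _ mN _ N0); first exact: mS.
  move=> x [[Dx /= gx] fx]; apply: NM => /= /(_ Dx).
  rewrite lerBlDr => h; move: fx; rewrite ltNge; apply/negP; rewrite negbK.
  by rewrite (le_trans h)// addrC lerD2r ltW.
have neg : mu.-negligible (\bigcup_n (if unpickle n is Some q then S fs q else set0)).
  apply: negligible_bigcup => n; case: (unpickle n) => [q|]; last exact: negligible_set0.
  apply/negligibleP; first exact: mS.
  by apply/eqP; rewrite -measure_le0 -(Sf0 q) Sle.
apply: negligibleS neg => x /=.
move=> /not_implyP[Dx /negP]; rewrite -ltNge ltrBrDr addrC -ltrBrDr => gx.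
have [q] := rat_in_itvoo gx; rewrite in_itv/= => /andP[gq qf].
exists (pickle q); first exact: Logic.I.
have -> : (if unpickle (pickle q) is Some q then S fs q else set0) = S fs q.
  by rewrite pickleK.
split; first by split.
by rewrite /= -ltrBrDr.
Qed.

End Comparison.
End Comonotone.

(** The rays ]y, +oo[ generate the Borel sets and are stable under intersection. Finiteness of mu D
    gives their measures by complement and makes the image measures finite on a cover by rays. *)
Lemma equimeasurable_rays d (T : measurableType d) (R : realType)
    (mu : {measure set T -> \bar R}) (D : set T) (u v : T -> R) :
  measurable D -> (mu D < +oo)%E ->
  measurable_fun setT u -> measurable_fun setT v ->
  (forall y, mu (D `&` [set x | u x <= y]) = mu (D `&` [set x | v x <= y])) ->
  equimeasurable mu D u v.
Proof.
move=> mD Doo meas_u mv uv B mB.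
pose m (w : T -> R) : set R -> \bar R := pushforward (mrestr mu mD) w.
have mE (w : T -> R) (A : set R) : m w A = mu (D `&` w @^-1` A).
  by rewrite /m /pushforward /mrestr setIC.
rewrite -!mE /m.
pose G := [set A : set R | exists y, A = `]y, +oo[%classic].
have raysE (w : T -> R) y : measurable_fun setT w ->
    mu (D `&` w @^-1` `]y, +oo[) = (mu D - mu (D `&` [set x | (w x <= y)%R]))%E.
  move=> mw; rewrite -measureD//.
  - congr (mu _); apply/seteqP; split => x /=; rewrite in_itv/= andbT.
      by case=> Dx yw; split => //; apply/negP; rewrite -ltNge.
    by case=> Dx /negP; rewrite -ltNge.
  - have -> : [set x | w x <= y] = w @^-1` `]-oo, y].
      by apply/seteqP; split => x /=; rewrite in_itv/=.
    by rewrite -[_ @^-1` _]setTI; exact: mw.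
apply: (measure_unique G (fun n => `](- n%:R)%R, +oo[%classic)) => //.
- exact: RGenOInfty.measurableE.
- move=> _ _ [x ->] [y ->]; exists (Num.max x y).
  apply/seteqP; split => z /=; rewrite !in_itv/= !andbT gt_max.
    by case=> -> ->.
  by move=> /andP[].
- by move=> n; exists (- n%:R).
- apply/seteqP; split => // x _; exists (Num.truncn `|x|).+1 => //=.
  rewrite in_itv/= andbT ltrNl (le_lt_trans (ler_norm _))// normrN.
  exact: truncnS_gt.
- move=> A [y ->]; rewrite -[LHS]/(m u _) -[RHS]/(m v _) !mE.
  by rewrite !raysE// uv.
- move=> n; rewrite -[X in (X < _)%E]/(m u _) mE; apply: le_lt_trans Doo.
  apply: le_measure; rewrite ?inE//; apply: measurableI => //.
  by rewrite -[_ @^-1` _]setTI; exact: meas_u.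
Qed.

(** * Affine images of Lebesgue measure *)

Section Affine.
Context {R : realType}.
Notation mu := (@lebesgue_measure R).

(** As a function of A the right-hand side is a measure with value y - x on each nonempty ]x, y],
    which characterizes Lebesgue measure. *)
Lemma lebesgue_measure_affine (a c : R) (A : set R) : 0 < c -> measurable A ->
  mu A = (c%:E * mu ((fun u => a + c * u)%R @^-1` A))%E.
Proof.
move=> c0 mA.
pose phi := (fun u => a + c * u) : measurableTypeR R -> measurableTypeR R.
have mphi : measurable_fun setT phi.
  by apply: measurable_funD => //; exact: mulrl_measurable.
have c0' : 0 <= c by exact: ltW.
pose cn := NngNum c0'.
rewrite (_ : (_ * _)%E = pushforward (mscale cn mu) phi A)//.
apply: lebesgue_measure_unique => //= X [[x y] _ <-].
rewrite /pushforward /mscale/=.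
have -> : phi @^-1` `]x, y] = `](x - a) / c, (y - a) / c]%classic.
  apply/seteqP; split => z /=; rewrite !in_itv/= /phi;
  by rewrite ltr_pdivrMr// ler_pdivlMr// ltrBlDl lerBrDl [z * c]mulrC.
rewrite !lebesgue_measure_itv/= !lte_fin ltr_pM2r ?invr_gt0// ltrD2r.
case: ifPn => _; last by rewrite mule0.
rewrite -!EFinB -EFinM -mulrBl opprB addrA subrK.
by rewrite mulrC divfK// gt_eqF.
Qed.

End Affine.

(** * Monotonicity and equimeasurability of the increasing rearrangement *)

Section RearrangementTheory.
Context {R : realType}.
Notation mu := (@lebesgue_measure R).
Variables (a b M : R) (f : R -> R).
Hypotheses (ab : a < b) (mf : measurable_fun `[a, b] f).
Hypothesis (fM : forall x, a <= x <= b -> `|f x| <= M).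

Let fbar u := f (a + (b - a) * u).
Let ba0 : 0 < b - a. Proof. by rewrite subr_gt0. Qed.
Let sub y := `[a, b]%classic `&` [set x | f x <= y].

Let msub y : measurable (sub y).
Proof.
have -> : sub y = `[a, b] `&` f @^-1` `]-oo, y].
  by apply/seteqP; split => x [? /=]; rewrite ?in_itv/=; split => //=; rewrite in_itv.
exact: mf.
Qed.

Let mu_sub_le y : (mu (sub y) <= mu `[a, b])%E.
Proof.
by apply: le_measure; rewrite ?inE; [exact: msub|exact: measurable_itv|move=> x []].
Qed.

Let level_cdfE y : mu (sub y) = ((b - a)%:E * level_cdf fbar y)%E.
Proof.
have phiE : (fun u => a + (b - a) * u) @^-1` (sub y) =
    `[0, 1] `&` [set u | fbar u <= y].
  have E u : (a <= a + (b - a) * u <= b) = (0 <= u <= 1).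
    rewrite lerDl pmulr_rge0// -lerBrDl.
    by rewrite -{2}[b - a]mulr1 ler_pM2l.
  by apply/seteqP; split => u; rewrite /sub /= !in_itv/= E.
have mphi : measurable_fun setT (fun u => a + (b - a) * u).
  by apply: measurable_funD => //; exact: mulrl_measurable.
have mS : measurable (`[0, 1]%classic `&` [set u | fbar u <= y]).
  by rewrite -phiE -[_ @^-1` _]setTI; exact: mphi.
rewrite (lebesgue_measure_affine a (b - a))// phiE /level_cdf; congr (_ * _)%E.
transitivity (\int[mu]_(u in `[0%R, 1%R])
    (\1_(`[0, 1]%classic `&` [set u | fbar u <= y]) u)%:E)%E.
  by rewrite integral_indic//; congr (mu _); apply/esym/setIidl => u [].
apply: eq_integral => u /set_mem u01; rewrite !indicE; congr (_%:R%:E).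
congr (nat_of_bool _); apply/idP/idP => /set_mem /=; first by case=> _ /mem_set.
by move=> h; apply/mem_set.
Qed.

Let level_cdf_fin y : level_cdf fbar y \is a fin_num.
Proof.
rewrite ge0_fin_numE; last by apply: integral_ge0 => u _; rewrite lee_fin.
have : (mu (sub y) < +oo)%E.
  apply: (@le_lt_trans _ _ (mu `[a, b])); first exact: mu_sub_le.
  by rewrite lebesgue_measure_itv/=; case: ifP => _; rewrite ?ltry.
rewrite level_cdfE; case: (level_cdf fbar y) => [r| |]; rewrite ?ltry ?ltNyy//.
by rewrite gt0_muley ?lte_fin// ltxx.
Qed.

Let F y := fine (level_cdf fbar y).

Let FE y : mu (sub y) = ((b - a) * F y)%:E.
Proof. by rewrite level_cdfE EFinM fineK. Qed.

Let F_ge0 y : 0 <= F y.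
Proof. by rewrite fine_ge0//; apply: integral_ge0 => u _; rewrite lee_fin. Qed.

Let F_le1 y : F y <= 1.
Proof.
rewrite -(ler_pM2l ba0) mulr1 -lee_fin -FE.
apply: (@le_trans _ _ (mu `[a, b])); first exact: mu_sub_le.
by rewrite lebesgue_measure_itv/= lte_fin ab EFinB.
Qed.

Let F_nd : nondecreasing_fun F.
Proof.
move=> x y xy; rewrite -(ler_pM2l ba0) -lee_fin -!FE.
apply: le_measure; rewrite ?inE; [exact: msub|exact: msub|].
by move=> z [? /= h]; split => //=; exact: le_trans xy.
Qed.

(** Together with [F_high], this makes the set in the infimum bounded below and nonempty at every
    positive argument up to 1. *)
Let F_low y : y < - M -> F y = 0.
Proof.
move=> yM; apply: (mulfI (lt0r_neq0 ba0)); rewrite mulr0; apply: EFin_inj.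
rewrite -FE (_ : sub y = set0) ?measure0//.
apply/seteqP; split => // z [/=]; rewrite in_itv/= => /fM; rewrite ler_norml.
by move=> /andP[Mz _] fzy; have := le_lt_trans (le_trans Mz fzy) yM; rewrite ltxx.
Qed.

Let F_high : F M = 1.
Proof.
apply: (mulfI (lt0r_neq0 ba0)); rewrite mulr1; apply: EFin_inj.
rewrite -FE (_ : sub M = `[a, b]%classic).
  by rewrite lebesgue_measure_itv/= lte_fin ab EFinB.
apply/seteqP; split => [z []//|z zab]; split => //=.
by move: zab; rewrite /= in_itv/= => /fM; rewrite ler_norml => /andP[].
Qed.

(* Makes the infimum that defines the rearrangement a minimum. *)
Let F_right_continuous y t : (forall n, t <= F (y + n.+1%:R^-1)) -> t <= F y.
Proof.
move=> tF; rewrite -(ler_pM2l ba0) -lee_fin -FE.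
have cv : mu (sub (y + n.+1%:R^-1)) @[n --> \oo] -->
    mu (\bigcap_n sub (y + n.+1%:R^-1)).
  apply: nonincreasing_cvg_mu.
  - by rewrite /= FE ltry.
  - by move=> n; exact: msub.
  - by apply: bigcapT_measurable => n; exact: msub.
  - move=> m n mn; apply/subsetPset => z [? /= h]; split => //=; apply: le_trans h _.
    by rewrite lerD2l lef_pV2 ?posrE// ler_nat.
have <- : \bigcap_n sub (y + n.+1%:R^-1) = sub y.
  apply/seteqP; split => [z zn|z [? /= h] n _]; last first.
    by split => //=; rewrite (le_trans h)// lerDl.
  split; first by have [] := zn 0%N Logic.I.
  rewrite /= leNgt; apply/negP => /ltr_add_invr[k].
  by have [_ /= h] := zn k Logic.I; rewrite ltNge h.
rewrite -(cvg_lim _ cv)//; apply: lime_ge; first by apply/cvg_ex; eexists; exact: cv.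
by apply: nearW => n; rewrite FE lee_fin ler_pM2l.
Qed.

(** The Galois connection between a quantile function and its distribution function. The bound a < x
    makes t positive; at t = 0 the set [S] would be all of R. *)
Lemma rearrangement_le x y : a < x <= b ->
  (rearrangement a b f x <= y) = ((x - a) / (b - a) <= F y).
Proof.
move=> /andP[ax xb]; rewrite /rearrangement /rearrangement01 -/fbar.
set t := (_ / _).
have t0 : 0 < t by rewrite divr_gt0// subr_gt0.
have t1 : t <= 1 by rewrite ler_pdivrMr// mul1r lerD2r.
set S := [set y | _].
have SE z : S z <-> t <= F z.
  by rewrite /S /=; rewrite -(fineK (level_cdf_fin z)) lee_fin.
have S0 : S !=set0 by exists M; apply/SE; rewrite F_high.
have Slb : lbound S (- M).
  move=> z /SE tz; rewrite leNgt; apply/negP => /F_low Fz.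
  by move: tz; rewrite Fz leNgt t0.
have hS : has_inf S by split => //; exists (- M).
apply/idP/idP => [infy|ty]; last by apply: (ge_inf hS.2); apply/SE.
apply: F_right_continuous => n.
have : inf S < y + n.+1%:R^-1 by rewrite (le_lt_trans infy)// ltrDl.
move=> /(inf_lt S0)[z /SE tz zy].
by apply: le_trans tz _; apply: F_nd; exact: ltW.
Qed.

Lemma rearrangement_nd x y : a < x -> x < y -> y <= b ->
  rearrangement a b f x <= rearrangement a b f y.
Proof.
move=> ax xy yb; rewrite rearrangement_le; last first.
  by rewrite ax (le_trans _ yb)// ltW.
have : (y - a) / (b - a) <= F (rearrangement a b f y).
  by rewrite -rearrangement_le// yb (lt_trans ax).
by apply: le_trans; rewrite ler_pM2r ?invr_gt0// lerD2r ltW.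
Qed.

Local Notation D := (`]a, b]%classic : set R).

(** An initial interval whose length is, by [FE], the measure of the sublevel set of f:
    measurability and equimeasurability both follow from this. *)
Let rearrangement_leE y :
  D `&` [set x | rearrangement a b f x <= y] = `]a, a + (b - a) * F y]%classic.
Proof.
apply/seteqP; split => x; rewrite /= !in_itv/=.
  case=> xab; rewrite rearrangement_le// ler_pdivrMr// lerBlDl mulrC => ->.
  by case/andP: xab => ->.
move=> /andP[ax xF].
have xb : x <= b.
  rewrite (le_trans xF)// -lerBrDl -{2}[b - a]mulr1 ler_pM2l//; exact: F_le1.
split; first by rewrite ax.
by rewrite rearrangement_le ?ax// ler_pdivrMr// lerBlDl mulrC.
Qed.

Lemma measurable_rearrangement : measurable_fun `]a, b] (rearrangement a b f).
Proof.
move=> mD; apply: (measurability _ (RGenOInfty.measurableE R)) => // _ [_ [y ->] <-].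
rewrite (_ : _ `&` _ = D `\` `]a, a + (b - a) * F y]); first exact: measurableD.
rewrite -rearrangement_leE; apply/seteqP; split => x /=; rewrite !in_itv/= ?andbT.
  by case=> xab yx; split => // -[_]; rewrite leNgt yx.
by case=> xab /not_andP[//|/negP]; rewrite -ltNge.
Qed.

Lemma equimeasurable_rearrangement :
  equimeasurable mu D (f \_ D) (rearrangement a b f \_ D).
Proof.
have patchD (h : R -> R) y : D `&` [set x | (h \_ D) x <= y] = D `&` [set x | h x <= y].
  by apply/seteqP; split => x [Dx] /=; rewrite patchE mem_set.
apply: equimeasurable_rays.
- exact: measurable_itv.
- by rewrite /= lebesgue_measure_itv/= lte_fin ab -EFinB ltry.
- apply/measurable_restrict => //; rewrite setTI; apply: measurable_funS mf => //.
  by move=> x /=; rewrite !in_itv/= => /andP[/ltW -> ->].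
- by apply/measurable_restrict => //; rewrite setTI; exact: measurable_rearrangement.
move=> y; rewrite !patchD rearrangement_leE/=.
have mS : measurable (D `&` [set x | f x <= y]).
  have -> : D `&` [set x | f x <= y] = D `&` sub y.
    apply/seteqP; split => x [Dx /=]; last by case.
    by move=> h; split => //; split => //; exact: subset_itv_oc_cc Dx.
  exact: measurableI.
(* The two sets differ at most by the endpoint a. *)
have -> : mu (D `&` [set x | f x <= y]) = mu (sub y).
  apply/eqP; rewrite eq_le; apply/andP; split.
    apply: le_measure; rewrite ?inE; [exact: mS|exact: msub|] => x [Dx h]; split => //.
    exact: subset_itv_oc_cc Dx.
  apply: (@le_trans _ _ (mu (D `&` [set x | f x <= y] `|` [set a]))); last first.
    by rewrite measureU0//; exact: lebesgue_measure_set1.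
  apply: le_measure; rewrite ?inE; [exact: msub|exact: measurableU|].
  move=> x [/=]; rewrite in_itv/= => /andP[ax xb] h.
  have [->|xa] := eqVneq x a; [by right|left; split => //=].
  by rewrite in_itv/= xb lt_neqAle eq_sym xa ax.
rewrite FE lebesgue_measure_itv/= lte_fin ltrDl.
case: ifPn => [_|]; first by rewrite -EFinB [a + _]addrC addrK.
rewrite -leNgt => h; congr (_%:E); apply/eqP.
by rewrite eq_le h mulr_ge0// ltW.
Qed.

End RearrangementTheory.

(** * Splitting a set of positive measure *)

Section Split.
Context {R : realType}.
Notation mu := (@lebesgue_measure R).

Lemma positive_measure_split (A : set R) : measurable A -> (0 < mu A)%E ->
  exists t, (0 < mu (A `&` `]-oo, t]))%E /\ (0 < mu (A `&` `]t, +oo[))%E.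
Proof.
move=> mA A0; apply: contrapT => nosplit.
pose L q : set R := A `&` `]-oo, ratr q].
pose H q : set R := A `&` `]ratr q, +oo[.
(* The null halves N q cover A up to one point: a rational strictly between
   two uncovered points would have one of them in its null half. *)
pose N (q : rat) := if mu (L q) == 0%E then L q else H q.
have mL q : measurable (L q) by apply: measurableI => //; exact: measurable_itv.
have mH q : measurable (H q) by apply: measurableI => //; exact: measurable_itv.
have N0 q : mu.-negligible (N q).
  rewrite /N; case: ifPn => [/eqP Lq0|Lq0]; first by apply/negligibleP; [exact: mL|exact: Lq0].
  apply/negligibleP; first exact: mH.
  apply/eqP; apply: contrapT => /negP Hq0.
  by apply: nosplit; exists (ratr q); rewrite !measure_gt0; split.
pose U := \bigcup_n (if unpickle n is Some q then N q else set0).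
have U0 : mu.-negligible U.
  by apply: negligible_bigcup => n; case: (unpickle n) => [q|] //; exact: negligible_set0.
have Usub x y : (A `\` U) x -> (A `\` U) y -> ~ (x < y).
  move=> [Ax Ux] [Ay Uy] xy; have [q] := rat_in_itvoo xy.
  rewrite in_itv/= => /andP[xq qy].
  have NU z : N q z -> U z.
    move=> Nz; exists (pickle q); first exact: Logic.I.
    by rewrite pickleK.
  move: NU; rewrite /N; case: ifPn => _ NU.
    by apply: Ux; apply: NU; split => //=; rewrite in_itv/= ltW.
  by apply: Uy; apply: NU; split => //=; rewrite in_itv/= qy.
have Z0 : mu.-negligible (A `\` U).
  have [[x xZ]|/set0P/negP/negPn/eqP ->] := pselect ((A `\` U) !=set0); last first.
    exact: negligible_set0.
  have x0 : mu.-negligible [set x].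
    by apply/negligibleP; [exact: measurable_set1|exact: lebesgue_measure_set1].
  apply: negligibleS x0 => y yZ /=; case: (ltgtP y x) => // yx.
    by have := Usub _ _ yZ xZ.
  by have := Usub _ _ xZ yZ.
have : mu.-negligible A.
  apply: negligibleS (negligibleU U0 Z0) => x Ax.
  by have [|] := pselect (U x); [left|right].
move/negligibleP => /(_ mA) A00.
by move: A0; rewrite A00 ltxx.
Qed.

(** Splitting at t1, then at t2, then the middle piece at t3 gives four pieces of positive measure.
    The inner two provide u1 <= t3 < u2; the outer two become the sets that witness strictness. *)
Lemma positive_measure_split3 (A : set R) : measurable A -> (0 < mu A)%E ->
  exists t1 u1 u2 t2, [/\ A u1, A u2, t1 < u1 < u2 & u2 <= t2] /\
    ((0 < mu (A `&` `]-oo, t1]))%E /\ (0 < mu (A `&` `]t2, +oo[))%E).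
Proof.
move=> mA A0.
have [t1 [L0 R0]] := positive_measure_split _ mA A0.
have mI (i : interval R) B : measurable B -> measurable (B `&` [set` i]).
  by move=> mB; apply: measurableI.
have [t2 [M0 H0]] := positive_measure_split _ (mI _ _ mA) R0.
have [t3 [M1 M2]] := positive_measure_split _ (mI _ _ (mI _ _ mA)) M0.
have ne (B : set R) : (0 < mu B)%E -> B !=set0.
  by move=> B0; apply/set0P/eqP => BE; move: B0; rewrite BE measure0 ltxx.
have [u1 [[[Au1 /=]]]] := ne _ M1; rewrite !in_itv/= andbT => t1u1 _ u1t3.
have [u2 [[[Au2 /=]]]] := ne _ M2; rewrite !in_itv/= !andbT => _ u2t2 t3u2.
exists t1, u1, u2, t2; split.
  by split => //; rewrite t1u1 (le_lt_trans u1t3).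
split => //; apply: lt_le_trans H0 _.
apply: le_measure; rewrite ?inE.
- by apply: measurableI => //; exact: measurableI.
- exact: measurableI.
- by move=> x [[Ax _] ?].
Qed.

End Split.

(** * The norm on [l, u] as an integral or an essential bound over ]l, u] *)

Section LnormI.
Context {R : realType}.
Notation mu := (@lebesgue_measure R).
Variables (l u : R) (h : R -> R).
Hypotheses (lu : l < u).

Lemma LnormI_fin r : 0 < r -> measurable_fun `]l, u] h ->
  LnormI l u r%:E h =
  ((\int[mu]_(x in `]l, u]) (`|h x| `^ r)%:E) `^ r^-1)%E.
Proof.
move=> r0 mh; rewrite /LnormI Lnorm.unlock.
suff -> : (\int[mu]_x (`|(EFin \o (h \_ `[l, u])) x| `^ r) =
  \int[mu]_(x in `]l, u]) (`|h x| `^ r)%:E)%E by [].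
rewrite integral_itv_obnd_cbnd; last first.
  apply/measurable_EFinP; apply: (@measurableT_comp _ _ _ _ _ _ (@powR R ^~ r)) => //.
  exact: measurableT_comp.
rewrite [RHS]integral_mkcond; apply: eq_integral => x _.
rewrite /= !patchE; case: ifPn => _ //.
by rewrite [LHS](_ : _ = (`|0 : R| `^ r)%:E)// normr0 powR0 ?gt_eqF.
Qed.

(** The bound [0 <= M] covers the value 0 of the extended function off [l, u]; the endpoint l is a
    null set. *)
Lemma LnormI_inftyP (M : R) : 0 <= M ->
  (LnormI l u +oo h <= M%:E)%E <->
  {ae mu, forall x, (`]l, u]%classic : set R) x -> `|h x| <= M}.
Proof.
move=> M0; rewrite /LnormI Lnorm.unlock.
have muT : (0 < mu [set: R])%E.
  apply: (@lt_le_trans _ _ (mu `]l, u])).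
    by rewrite lebesgue_measure_itv/= lte_fin lu EFinN -EFinB lte_fin subr_gt0.
  by apply: le_measure; rewrite ?inE.
rewrite muT; split.
  move=> /ess_supP; apply: filterS => x /=; rewrite patchE => + xlu.
  by rewrite mem_set ?lee_fin//; exact: subset_itv_oc_cc xlu.
move=> hM; apply/ess_supP.
have xl : {ae mu, forall x, x != l}.
  exists [set l]; split => //; first exact: lebesgue_measure_set1.
  by move=> x /= /negP/negPn/eqP.
apply: (@filterS2 _ _ (ae_filter_ringOfSetsType mu) _ _ _ _ xl hM) => x {}xl /= hx; rewrite patchE.
case: ifPn => [/set_mem/=|_]; last by rewrite (_ : point = 0 :> R)// normr0 lee_fin.
rewrite in_itv/= => /andP[lx xu]; rewrite lee_fin; apply: hx.
by rewrite /= in_itv/= xu lt_neqAle eq_sym xl lx.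
Qed.

End LnormI.

(** * Error bounds for an increasing target F *)

Section Estimate.
Context {R : realType}.
Notation mu := (@lebesgue_measure R).
Variables (l u e : R) (F f : R -> R).
Hypotheses (lu : l < u) (Finc : forall x y, x < y -> F x < F y).
Hypotheses (mf : measurable_fun `[l, u] f).
Hypothesis (fF : forall x, l <= x <= u -> `|F x - f x| <= e).

Local Notation D := (`]l, u]%classic : set R).
Local Notation fstar := (rearrangement l u f).
Let err p (G : R -> R) := LnormI l u p (fun x => G x - F x).

Let F_nd : nondecreasing_fun F.
Proof. by move=> x y; rewrite le_eqVlt => /predU1P[->//|/Finc/ltW]. Qed.

Let mF : measurable_fun setT F. Proof. exact: nondecreasing_measurable. Qed.

Let mD : measurable D. Proof. exact: measurable_itv. Qed.

Let muD : mu D = (u - l)%:E.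
Proof. by rewrite lebesgue_measure_itv/= lte_fin lu EFinB. Qed.

Let Doo : (mu D < +oo)%E. Proof. by rewrite muD ltry. Qed.

(** The rearrangement is controlled for bounded f; here the bound comes from F, which stays between
    F l and F u and within e of f. *)
Let fM x : l <= x <= u -> `|f x| <= `|F l| + `|F u| + e.
Proof.
move=> /[dup] /fF h /andP[lx xu].
rewrite -[f x](subKr (F x)) (le_trans (ler_normB _ _))// lerD//.
have [F0|F0] := leP 0 (F x).
  by rewrite ger0_norm// (le_trans (F_nd _ _ xu))// (le_trans (ler_norm _))// lerDr.
by rewrite ltr0_norm// (@le_trans _ _ (- F l)) ?lerN2 ?F_nd// -normrN
  (le_trans (ler_norm _))// lerDl.
Qed.

Let mfD : measurable_fun D f.
Proof.
by apply: measurable_funS mf => //; exact: subset_itv_oc_cc.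
Qed.

Let mfstar : measurable_fun D fstar.
Proof. exact: (measurable_rearrangement _ _ _ _ lu mf fM). Qed.

Let mrestrictD (h : R -> R) : measurable_fun D h -> measurable_fun setT (h \_ D).
Proof. by move=> mh; apply/measurable_restrict => //; rewrite setTI. Qed.

Let eqf : equimeasurable mu D (f \_ D) (fstar \_ D).
Proof. exact: (equimeasurable_rearrangement _ _ _ _ lu mf fM). Qed.

Let restrictDE (h : R -> R) x : D x -> (h \_ D) x = h x.
Proof. by move=> Dx; rewrite patchE mem_set. Qed.

Let costar : comonotone_on D (fstar \_ D) F.
Proof.
move=> x y Dx Dy Fxy; rewrite !restrictDE//.
have xy : x < y by rewrite ltNge; apply/negP => /F_nd; rewrite leNgt Fxy.
move: Dx Dy; rewrite /= !in_itv/= => /andP[lx _] /andP[_ yu].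
exact: (rearrangement_nd _ _ _ _ lu mf fM).
Qed.

Let errE r (h : R -> R) : 0 < r -> measurable_fun D h ->
  err r%:E h = ((\int[mu]_(x in D) (`|(h \_ D) x - F x| `^ r)%:E) `^ r^-1)%E.
Proof.
move=> r0 mh.
have mhF : measurable_fun D (fun x => h x - F x).
  by apply: measurable_funB => //; exact: measurable_funTS.
rewrite /err (LnormI_fin _ _ _ _ r0 mhF).
suff -> : (\int[mu]_(x in D) (`|h x - F x| `^ r)%:E =
  \int[mu]_(x in D) (`|(h \_ D) x - F x| `^ r)%:E)%E by [].
by apply: eq_integral => x /set_mem Dx; rewrite restrictDE.
Qed.

Let int_ge0 r (h : R -> R) : (0 <= \int[mu]_(x in D) (`|h x - F x| `^ r)%:E)%E.
Proof. by apply: integral_ge0 => x _; rewrite lee_fin powR_ge0. Qed.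

Let e0 : 0 <= e.
Proof. by apply: le_trans (fF l _); rewrite ?normr_ge0// lexx ltW. Qed.

Let Df x : D x -> `|f x - F x| <= e.
Proof.
rewrite /= in_itv/= distrC => /andP[lx xu]; apply: fF.
by rewrite xu ltW.
Qed.

(** Gives the upper error bound, and also the finiteness that the strict comparison requires. *)
Let int_le r : 0 <= r ->
  (\int[mu]_(x in D) (`|(f \_ D)%R x - F x| `^ r)%:E <= (e `^ r * (u - l))%:E)%E.
Proof.
move=> r0; rewrite EFinM -muD -integral_cst//; apply: ge0_le_integral.
- exact: mD.
- by move=> x _; rewrite lee_fin powR_ge0.
- apply/measurable_EFinP; apply: (@measurableT_comp _ _ _ _ _ _ (@powR R ^~ r)) => //.
  apply: measurableT_comp => //; apply: measurable_funTS.
  by apply: measurable_funB => //; exact: mrestrictD.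
- exact: measurable_cst.
- move=> x Dx; rewrite lee_fin restrictDE//.
  by apply: ge0_ler_powR; rewrite ?nnegrE//; exact: Df.
Qed.

Let norm_ae (M : R) : {ae mu, forall x, D x -> `|f x - F x| <= M} ->
  {ae mu, forall x, D x -> `|fstar x - F x| <= M}.
Proof.
move=> fae.
have S2 := @filterS2 _ _ (ae_filter_ringOfSetsType mu).
have S1 := @filterS _ _ (ae_filter_ringOfSetsType mu).
have mN (h : R -> R) : measurable_fun setT h -> measurable_fun setT (fun x => - h x).
  by move=> mh; exact: measurable_funN.
have up : {ae mu, forall x, D x -> (fstar \_ D) x - F x <= M}.
  apply: (comonotone_ae_le _ _ _ mu D mD _ (f \_ D)) => //.
  - exact: mrestrictD.
  - exact: mrestrictD.
  - move: fae; apply: S1 => x + Dx => /(_ Dx); rewrite restrictDE//.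
    by rewrite ler_norml => /andP[].
have lo : {ae mu, forall x, D x -> - (fstar \_ D) x - (- F x) <= M}.
  apply: (comonotone_ae_le _ _ _ mu D mD _ (fun x => - (f \_ D) x) (fun x => - (fstar \_ D) x)
     (fun x => - F x)) => //.
  - by apply: mN; exact: mrestrictD.
  - by apply: mN; exact: mrestrictD.
  - exact: mN.
  - exact: equimeasurableN.
  - exact: comonotone_onN.
  - move: fae; apply: S1 => x + Dx => /(_ Dx); rewrite restrictDE//.
    by rewrite ler_norml -opprD lerNl => /andP[].
apply: S2 up lo => x + + Dx => /(_ Dx) + /(_ Dx); rewrite restrictDE// => h1 h2.
by rewrite ler_norml h1 andbT lerNl opprD.
Qed.

Lemma rearrangement_err_le p : (1 <= p)%E -> (err p fstar <= err p f)%E.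
Proof.
case: p => [r||//]; last first.
  (* When the norm of f - F is a finite M, the claim says that the essential bound M passes from f
     to its rearrangement. *)
  move=> _; case E : (err +oo%E f) => [M| |]; last 2 first.
  - exact: leey.
  - by have := Lnorm_ge0 lebesgue_measure +oo%E (EFin \o ((fun x => f x - F x) \_ `[l, u]));
      rewrite -[X in (_ <= X)%E]/(err +oo%E f) E.
  have M0 : 0 <= M.
    by rewrite -lee_fin -E; exact: Lnorm_ge0.
  apply/(LnormI_inftyP _ _ _ lu _ M0); apply: norm_ae.
  by apply/(LnormI_inftyP _ _ _ lu _ M0); rewrite -E.
rewrite lee_fin => r1; have r0 : 0 < r by exact: lt_le_trans r1.
rewrite (errE _ _ r0 mfstar) (errE _ _ r0 mfD); apply: gt0_ler_poweR.
- by rewrite invr_ge0 ltW.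
- by rewrite in_itv/= int_ge0 leey.
- by rewrite in_itv/= int_ge0 leey.
- apply: comonotone_integral_norm_le => //; exact: mrestrictD.
Qed.

Lemma err_le p : (1 <= p)%E -> (err p f <= (root_length (u - l) p * e)%:E)%E.
Proof.
case: p => [r||//]; last first.
  move=> _; rewrite mul1r; apply/(LnormI_inftyP _ _ _ lu _ e0).
  exact/nearW.
rewrite lee_fin => r1; have r0 : 0 < r by exact: lt_le_trans r1.
rewrite (errE _ _ r0 mfD).
have -> : (root_length (u - l) r%:E * e)%:E = (((e `^ r * (u - l))%:E) `^ r^-1)%E.
  rewrite poweR_EFin /= powRM ?powR_ge0 ?subr_ge0 ?(ltW lu)//.
  by rewrite -powRrM mulfV ?gt_eqF// powRr1// mulrC.
apply: gt0_ler_poweR.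
- by rewrite invr_ge0 ltW.
- by rewrite in_itv/= int_ge0 leey.
- by rewrite in_itv/= leey andbT lee_fin mulr_ge0 ?powR_ge0// subr_ge0 ltW.
- by apply: int_le; exact: ltW.
Qed.

Lemma rearrangement_err_lt (A : set R) p : measurable A -> A `<=` `[l, u] ->
  (0 < mu A)%E -> strictly_decreasing_on A f ->
  (1 < p)%E -> (p < +oo)%E -> (err p fstar < err p f)%E.
Proof.
move=> mA Alu A0 decA; case: p => [r||//] r1 //.
move=> _; rewrite lte_fin in r1; have r0 : 0 < r by exact: lt_trans r1.
pose B := A `&` D.
have mB : measurable B by exact: measurableI.
have B0 : (0 < mu B)%E.
  apply: lt_le_trans A0 _.
  apply: (@le_trans _ _ (mu (B `|` [set l]))); last first.
    by rewrite measureU0//; exact: lebesgue_measure_set1.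
  apply: le_measure; rewrite ?inE; [exact: mA|exact: measurableU|].
  move=> x Ax; have [->|xl] := eqVneq x l; [by right|left; split => //].
  by move: (Alu _ Ax); rewrite /= !in_itv/= => /andP[lx ->]; rewrite lt_neqAle eq_sym xl lx.
have [t1 [u1 [u2 [t2 [[[Au1 Du1] [Au2 Du2] /andP[tu1 u12] u2t2] [B1 B2]]]]]] :=
  positive_measure_split3 _ mB B0.
have BD (i : interval R) : B `&` [set` i] `<=` D by move=> x [[]].
have foo : (\int[mu]_(x in D) (`|(f \_ D)%R x - F x| `^ r)%:E < +oo)%E.
  by apply: le_lt_trans (int_le _ (ltW r0)) _; rewrite ltry.
have lt_int : (\int[mu]_(x in D) (`|(fstar \_ D)%R x - F x| `^ r)%:E <
    \int[mu]_(x in D) (`|(f \_ D)%R x - F x| `^ r)%:E)%E.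
  (* As u1 and u2 lie in A between the outer pieces, f is at least f u1 on the left piece and at
     most f u2 on the right one, while F is at most F u1 and at least F u2 there. *)
  apply: (comonotone_integral_norm_lt _ _ _ mu D mD Doo (f \_ D) (fstar \_ D) F
    (mrestrictD _ mfD) (mrestrictD _ mfstar) mF eqf costar r
    (B `&` `]-oo, t1]) (B `&` `]t2, +oo[) (f u1) (f u2) (F u1) (F u2) r1
    (measurableI _ _ mB (measurable_itv _)) (measurableI _ _ mB (measurable_itv _))
    (BD _) (BD _) B1 B2).
  - exact: decA.
  - exact: Finc.
  - move=> x [[Ax Dx] /=]; rewrite in_itv/= restrictDE// => xt.
    by apply: ltW; apply: decA => //; exact: le_lt_trans tu1.
  - move=> x [[Ax Dx] /=]; rewrite in_itv/= andbT restrictDE// => tx.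
    by apply: ltW; apply: decA => //; exact: le_lt_trans tx.
  - move=> x [[Ax Dx] /=]; rewrite in_itv/= => xt.
    by apply: F_nd; rewrite (le_trans xt)// ltW.
  - move=> x [[Ax Dx] /=]; rewrite in_itv/= andbT => tx.
    by apply: F_nd; rewrite (le_trans u2t2)// ltW.
  - exact: foo.
rewrite (errE _ _ r0 mfstar) (errE _ _ r0 mfD).
move: lt_int foo; set I := integral _ _ _; set J := integral _ _ _ => IJ Joo.
have I0 : (0 <= I)%E by exact: int_ge0.
have J0 : (0 <= J)%E by exact: int_ge0.
have Ioo := lt_trans IJ Joo.
(* Both integrals are finite, so the strict inequality survives the real power 1/r. *)
clearbody I J; move: I J I0 J0 IJ Joo Ioo => [x| |] [y| |] //=.
rewrite !lee_fin lte_fin => x0 y0 xy _ _.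
by rewrite lte_fin gt0_ltr_powR ?invr_gt0 ?nnegrE.
Qed.

End Estimate.

(** * Measurability of the Edgeworth approximation *)

Section EdgeworthMeasurable.
Context {R : realType}.

Lemma measurable_normal_cdf : measurable_fun setT (@normal_cdf R).
Proof.
apply: nondecreasing_measurable => // x y xy; rewrite /normal_cdf fine_le//.
- by rewrite fin_num_measure.
- by rewrite fin_num_measure.
- by apply: le_measure; rewrite ?inE//; exact: subset_itvl.
Qed.

Lemma measurable_edgeworth_term (m : nat -> R) j :
  measurable_fun setT (edgeworth_term m j).
Proof.
case: j => [|[|j]]; [exact: measurable_cst|exact: measurable_normal_cdf|].
apply: measurable_funM; last exact: measurable_normal_pdf.
apply: measurable_funN; apply: measurable_sum => i.
by apply: measurable_funM => //; exact: measurable_poly.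
Qed.

Lemma measurable_edgeworth_approx (m : nat -> R) J n :
  measurable_fun setT (edgeworth_approx m J n).
Proof.
apply: measurable_sum => j; apply: measurable_funM => //.
exact: measurable_edgeworth_term.
Qed.

End EdgeworthMeasurable.

Theorem proposition3 (R : realType) :
  (forall (d : nat -> measure_display) (T : forall n, measurableType (d n))
      (P : forall n, probability (T n) R) (X : forall n, {RV (P n) >-> R})
      (F : nat -> R -> R) (a b c : nat -> R) (Fhat eps : nat -> R -> R),
    (forall n x, (F n x)%:E = cdf (X n) x) ->
    (forall n x y, x < y -> F n x < F n y) ->
    (forall n, 0 < b n) -> (forall n, 0 < c n) ->
    (forall n, 0 < a n) -> a @ \oo --> 0 ->
    (forall n, measurable_fun `[- b n, c n] (Fhat n)) ->
    (forall n x, - b n <= x <= c n ->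
       F n x = Fhat n x + eps n x /\ `|eps n x| <= a n) ->
    forall n : nat,
      let Fstar := rearrangement (- b n) (c n) (Fhat n) in
      let err (p : \bar R) (G : R -> R) :=
        LnormI (- b n) (c n) p (fun x => G x - F n x) in
      (forall p : \bar R, (1 <= p)%E ->
         (err p Fstar <= err p (Fhat n))%E /\
         (err p (Fhat n) <= (root_length (c n + b n) p * a n)%:E)%E) /\
      ((exists A : set R, [/\ measurable A, A `<=` `[- b n, c n],
           (0 < lebesgue_measure A)%E & strictly_decreasing_on A (Fhat n)]) ->
       forall p : \bar R, (1 < p)%E -> (p < +oo)%E ->
         (err p Fstar < err p (Fhat n))%E))
  /\
  (forall (d0 : measure_display) (T0 : measurableType d0)
      (P0 : probability T0 R) (Y0 : {RV P0 >-> R})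
      (d : nat -> measure_display) (T : forall n, measurableType (d n))
      (P : forall n, probability (T n) R)
      (Y : forall n, 'I_n -> {RV (P n) >-> R})
      (X : forall n, {RV (P n) >-> R})
      (F : nat -> R -> R) (b c : nat -> R) (J : nat) (C : R),
    (0 < J)%N ->
    P0.-integrable setT (fun w => (Y0 w ^+ J.+1)%:E) ->
    (0 < 'V_P0[Y0])%E ->
    (forall n, (0 < n)%N -> random_sample Y0 (Y n)) ->
    (forall n, (0 < n)%N -> forall w, X n w = standardized_mean (Y n) w) ->
    (forall n, (0 < n)%N -> forall x, (F n x)%:E = cdf (X n) x) ->
    (forall n, (0 < n)%N -> forall x y, x < y -> F n x < F n y) ->
    (forall n, (0 < n)%N -> 0 < b n /\ 0 < c n) ->
    0 < C ->
    let Fhat := edgeworth_approx (standardized_moment Y0) J in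
    (forall n, (0 < n)%N -> forall x, - b n <= x <= c n ->
       `|F n x - Fhat n x| <= C * n%:R `^ (- (J%:R / 2))) ->
    forall n : nat, (0 < n)%N ->
      let Fstar := rearrangement (- b n) (c n) (Fhat n) in
      let err (p : \bar R) (G : R -> R) :=
        LnormI (- b n) (c n) p (fun x => G x - F n x) in
      (forall p : \bar R, (1 <= p)%E ->
         (err p Fstar <= err p (Fhat n))%E /\
         (err p (Fhat n) <=
            (root_length (c n + b n) p * (C * n%:R `^ (- (J%:R / 2))))%:E)%E) /\
      ((exists A : set R, [/\ measurable A, A `<=` `[- b n, c n],
           (0 < lebesgue_measure A)%E & strictly_decreasing_on A (Fhat n)]) ->
       forall p : \bar R, (1 < p)%E -> (p < +oo)%E ->
         (err p Fstar < err p (Fhat n))%E)).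

Proof.
split.
  move=> d T P X F a b c Fhat eps _ Finc b0 c0 _ _ mFhat Feps n /=.
  have lu : - b n < c n by rewrite (lt_trans _ (c0 n))// oppr_lt0.
  have FF x : - b n <= x <= c n -> `|F n x - Fhat n x| <= a n.
    by move=> /(Feps n)[-> ?]; rewrite [Fhat n x + _]addrC addrK.
  have -> : c n + b n = c n - - b n by rewrite opprK.
  split=> [p p1|[A [mA Asub A0 decA]] p]; first split.
  - exact: (rearrangement_err_le _ _ _ _ _ lu (Finc n) (mFhat n) FF).
  - exact: (err_le _ _ _ _ _ lu (Finc n) (mFhat n) FF).
  - exact: (rearrangement_err_lt _ _ _ _ _ lu (Finc n) (mFhat n) FF A).
move=> d0 T0 P0 Y0 d T P Y X F b c J C _ _ _ _ _ _ Finc bc0 _ Fhat FF n n0 /=.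
have [b0 c0] := bc0 n n0.
have lu : - b n < c n by rewrite (lt_trans _ c0)// oppr_lt0.
(* Measurability, assumed in the general case, follows here from the form of the terms: a monotone
   distribution function, and polynomials times a density. *)
have mFhat : measurable_fun `[- b n, c n] (Fhat n).
  by apply: measurable_funTS; exact: measurable_edgeworth_approx.
have -> : c n + b n = c n - - b n by rewrite opprK.
split=> [p p1|[A [mA Asub A0 decA]] p]; first split.
- exact: (rearrangement_err_le _ _ _ _ _ lu (Finc n n0) mFhat (FF n n0)).
- exact: (err_le _ _ _ _ _ lu (Finc n n0) mFhat (FF n n0)).
- exact: (rearrangement_err_lt _ _ _ _ _ lu (Finc n n0) mFhat (FF n n0) A).
Qed.
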